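(* For every integer $k \ge 2$, $\operatorname{hcl}(k) \ge \mathrm{sf}(k-1)\,\mathrm{sf}(k-2)$.
   Context: Lattice paths go from $(0,0)$ to $(m,r)$ using steps $E=(1,0)$ and $N=(0,1)$, and are written as words of length $m+r$ over $\{E,N\}$. Given such a path $Q$, the generalized Catalan matroid $M[Q]$ is the matroid on ground set $[m+r]=\{1,\dots,m+r\}$ whose bases are the sets $B=\{j : \text{the $j$th step of } L \text{ is } N\}$ for the lattice paths $L$ from $(0,0)$ to $(m,r)$ that never go above $Q$ (equivalently, for each $i$, the $i$th $N$ step of $L$ occurs at a position no earlier than the $i$th $N$ step of $Q$). It has rank $r$ and corank $m$. The $k$-Catalan matroid is $M[(NE)^k]$. For a matroid $M$, its basis graph $\operatorname{BG}(M)$ has the bases of $M$ as vertices, two bases $B,B'$ being adjacent if and only if $|B\triangle B'|=2$. For an edge $\epsilon$ of $\operatorname{BG}(M)$, let $\operatorname{HC}_\epsilon(M)$ be the number of distinct Hamiltonian cycles of $\operatorname{BG}(M)$ containing $\epsilon$, and define $\operatorname{HC}^*(M)=\min_\epsilon \operatorname{HC}_\epsilon(M)$. Define $\operatorname{hcl}(k)=\min\{\operatorname{HC}^*(M[Q]) : M[Q] \text{ is a generalized Catalan matroid having the $k$-Catalan matroid as a minor}\}$. The superfactorial is $\mathrm{sf}(x)=x!\,(x-1)!\cdots 0!$ for an integer $x\ge 0$. *)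

(* Defs.v *)
From HB Require Import structures.
From mathcomp Require Import all_boot.
From mathcomp Require Import boolp.

Set Implicit Arguments.
Unset Strict Implicit.
Unset Printing Implicit Defensive.

Record matroid (T : finType) := Matroid {
  ground : {set T};
  bases : {set {set T}};
  bases_ground : forall B, B \in bases -> B \subset ground;
  bases_neq0 : bases != set0;
  bases_exchange : forall B1 B2 x, B1 \in bases -> B2 \in bases ->
    x \in B1 :\: B2 ->
    exists2 y, y \in B2 :\: B1 & y |: (B1 :\ x) \in bases }.

Definition indep (T : finType) (M : matroid T) : {set {set T}} :=
  [set I : {set T} | [exists B in bases M, I \subset B]].

Section MatroidFacts.
Variables (T : finType) (M : matroid T).
Implicit Types (A B F I : {set T}).

Let exch_card B1 B2 x y : x \in B1 :\: B2 -> y \in B2 :\: B1 ->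
  #|(y |: (B1 :\ x)) :\: B2| < #|B1 :\: B2|.
Proof.
move=> xB yB; apply: proper_card; apply/properP; split.
  apply/subsetP=> z; move: yB; rewrite !inE => /andP[_ yB2].
  by case/andP=> zB2 /orP[/eqP zy|/andP[_ ->]]; [rewrite zy yB2 in zB2 | rewrite zB2].
exists x => //; move: xB yB; rewrite !inE eqxx => /andP[xB2 xB1] /andP[yB1 yB2].
by rewrite (negPf xB2) orbF /=; apply: contraNN yB1 => /eqP <-.
Qed.

Let exch_size B1 B2 x y : x \in B1 :\: B2 -> y \in B2 :\: B1 ->
  #|y |: (B1 :\ x)| = #|B1|.
Proof.
rewrite !inE => /andP[_ xB1] /andP[yB1 _].
by rewrite cardsU1 !inE (negPf yB1) andbF (cardsD1 x B1) xB1.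
Qed.

Lemma bases_leq B1 B2 : B1 \in bases M -> B2 \in bases M -> #|B1| <= #|B2|.
Proof.
elim: {B1}_.+1 {-2}B1 (ltnSn #|B1 :\: B2|) => // n IH B1 lt_n B1M B2M.
have [/eqP|[x xB]] := set_0Vmem (B1 :\: B2).
  by rewrite setD_eq0; apply: subset_leq_card.
have [y yB BM] := bases_exchange B1M B2M xB.
rewrite -(exch_size xB yB); apply: IH => //.
by apply: leq_trans (exch_card xB yB) _; rewrite -ltnS.
Qed.

Lemma bases_card B1 B2 : B1 \in bases M -> B2 \in bases M -> #|B1| = #|B2|.
Proof. by move=> B1M B2M; apply/eqP; rewrite eqn_leq !bases_leq. Qed.

Lemma bases_augment F B1 B2 : B1 \in bases M -> B2 \in bases M ->
  #|B1 :&: F| < #|B2 :&: F| ->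
  exists z B, [/\ z \in B2, z \notin B1, z \in F, B \in bases M
                & z |: (B1 :&: F) \subset B].
Proof.
elim: {B1}_.+1 {-2}B1 (ltnSn #|B1 :\: B2|) => // n IH B1 lt_n B1M B2M ltF.
have [z zB zF] : exists2 z, z \in B1 :\: B2 & z \notin F.
  have lt2 : #|B2 :\: F| < #|B1 :\: F|.
    have := bases_card B1M B2M.
    rewrite -(cardsID F B1) -(cardsID F B2) => e.
    by rewrite -(ltn_add2l #|B1 :&: F|) e ltn_add2r.
  have : ~~ (B1 :\: F \subset B2 :\: F).
    by apply/negP=> /subset_leq_card; rewrite leqNgt lt2.
  case/subsetPn=> z; rewrite !inE => /andP[zF zB1]; rewrite zF /= => zB2.
  by exists z; rewrite ?inE ?zB2.
have [y yB BM] := bases_exchange B1M B2M zB.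
have capF : y \notin F -> (y |: (B1 :\ z)) :&: F = B1 :&: F.
  move=> yF; apply/setP=> t; rewrite !inE.
  case tF: (t \in F); last by rewrite !andbF.
  rewrite !andbT; case: eqP => [ty|_ /=]; first by rewrite -ty tF in yF.
  by case: eqP => // tz; rewrite -tz tF in zF.
case yF: (y \in F).
  exists y, (y |: (B1 :\ z)); move: yB; rewrite !inE => /andP[-> ->]; split=> //.
  apply/subsetP=> t; rewrite !inE => /orP[->//|/andP[-> tF]].
  by rewrite andbT; apply/orP; right; apply: contraNneq zF => <-.
have lt' := leq_trans (exch_card zB yB) (lt_n : _ <= n).
have [|t [B [tB2 tB1 tF BM' sub]]] := IH _ lt' BM B2M.
  by rewrite capF ?yF.
rewrite capF ?yF // in sub; exists t, B; split=> //.
apply: contraNN tB1 => tB1; rewrite !inE tB1 andbT; apply/orP; right.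
by apply: contraNneq zF => <-.
Qed.

Section Dual.

Definition dual_bases : {set {set T}} := [set ground M :\: B | B in bases M].

Fact dual_ground B : B \in dual_bases -> B \subset ground M.
Proof. by case/imsetP=> A _ ->; apply: subsetDl. Qed.

Fact dual_neq0 : dual_bases != set0.
Proof.
have /set0Pn[B BM] := bases_neq0 M.
by apply/set0Pn; exists (ground M :\: B); apply: imset_f.
Qed.

Lemma bases_coexchange B1 B2 x : B1 \in bases M -> B2 \in bases M ->
  x \in B2 :\: B1 ->
  exists2 y, y \in B1 :\: B2 & x |: (B1 :\ y) \in bases M.
Proof.
move=> B1M B2M; rewrite inE => /andP[xB1 xB2].
have [B [xB BM sB sB1]] : exists B, [/\ x \in B, B \in bases M,
    B1 :&: B2 \subset B & B \subset x |: B1].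
  suff: forall n B, #|B :\: B1| < n -> x \in B -> B \in bases M ->
      B1 :&: B2 \subset B -> exists B, [/\ x \in B, B \in bases M,
      B1 :&: B2 \subset B & B \subset x |: B1].
    by move=> /(_ _ B2 (ltnSn _)); apply=> //; apply: subsetIr.
  elim=> // n IH B lt_n xB BM sB.
  have [sB1|/subsetPn[w wB]] := boolP (B \subset x |: B1); first by exists B.
  rewrite !inE negb_or => /andP[wx wB1].
  have wD : w \in B :\: B1 by rewrite inE wB1.
  have [y yD B'M] := bases_exchange BM B1M wD.
  apply: (IH (y |: (B :\ w))) => //.
  - exact: leq_trans (exch_card wD yD) _.
  - by rewrite !inE (eq_sym x w) wx xB orbT.
  apply/subsetP=> t tI; rewrite !inE (subsetP sB _ tI) andbT; apply/orP; right.
  by apply: contraNneq wB1 => <-; move: tI; rewrite inE => /andP[].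
have [y yB1 yB] : exists2 y, y \in B1 & y \notin B.
  apply/subsetPn/negP=> sub.
  have : x |: B1 \subset B by rewrite subUset sub1set xB.
  move/subset_leq_card; rewrite cardsU1 xB1 (bases_card B1M BM).
  by rewrite add1n ltnn.
exists y.
  rewrite inE yB1 andbT; apply: contraNN yB => yB2.
  by apply: (subsetP sB); rewrite inE yB1.
suff -> : x |: (B1 :\ y) = B by [].
apply/esym/eqP; rewrite eqEcard; apply/andP; split.
  apply/subsetP=> t tB; have := subsetP sB1 _ tB; rewrite !inE.
  case/orP=> [->//|->]; rewrite andbT; apply/orP; right.
  by apply: contraNneq yB => <-.
rewrite -(bases_card B1M BM) cardsU1 !inE (negPf xB1) andbF.
by rewrite (cardsD1 y B1) yB1.
Qed.

Fact dual_exchange B1 B2 x : B1 \in dual_bases -> B2 \in dual_bases ->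
  x \in B1 :\: B2 ->
  exists2 y, y \in B2 :\: B1 & y |: (B1 :\ x) \in dual_bases.
Proof.
case/imsetP=> A1 A1M -> /imsetP[A2 A2M ->] xD.
have xA : x \in A2 :\: A1.
  move: xD; rewrite !inE.
  by case: (x \in ground M); case: (x \in A1); case: (x \in A2).
have xE : x \in ground M by move: xD; rewrite !inE => /and3P[].
have [y yA AM] := bases_coexchange A1M A2M xA.
move: (yA); rewrite inE => /andP[yA2 yA1].
have yE := subsetP (bases_ground A1M) _ yA1.
exists y; first by rewrite !inE yA1 yA2 yE.
apply/imsetP; exists (x |: (A1 :\ y)) => //.
apply/setP=> t; rewrite !inE negb_or negb_and negbK.
case: (eqVneq t y) => [->|ty] /=; last by rewrite andbA.
rewrite yE !andbT; apply/esym/negP => /eqP yx.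
by move: xA; rewrite inE -yx yA1.
Qed.

Definition dual : matroid T := Matroid dual_ground dual_neq0 dual_exchange.

End Dual.

Section Deletion.
Variable Y : {set T}.

Definition deletion_bases : {set {set T}} :=
  [set I | maxset (fun J => (J \in indep M) && (J \subset ground M :\: Y)) I].

Fact deletion_ground I : I \in deletion_bases -> I \subset ground M :\: Y.
Proof. by rewrite inE => /maxsetp/andP[]. Qed.

Fact deletion_neq0 : deletion_bases != set0.
Proof.
have /set0Pn[B BM] := bases_neq0 M.
have [|I maxI _] := @maxset_exists _
    (fun J => (J \in indep M) && (J \subset ground M :\: Y)) set0.
  rewrite sub0set andbT inE; apply/existsP; exists B.
  by rewrite BM sub0set.
by apply/set0Pn; exists I; rewrite inE.
Qed.

Lemma deletion_basesP I : reflect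
  (exists B, [/\ B \in bases M, I = B :&: (ground M :\: Y)
    & forall B', B' \in bases M ->
        #|B' :&: (ground M :\: Y)| <= #|B :&: (ground M :\: Y)|])
  (I \in deletion_bases).
Proof.
set F := ground M :\: Y; rewrite inE; apply: (iffP idP).
  case/maxsetP=> /andP[+ sIF] maxI; rewrite inE => /existsP[B /andP[BM sIB]].
  have indF B' (J : {set T}) : B' \in bases M -> J \subset B' :&: F ->
      (J \in indep M) && (J \subset F).
    rewrite subsetI => B'M /andP[sJB ->]; rewrite andbT inE.
    by apply/existsP; exists B'; rewrite B'M.
  have eI : I = B :&: F.
    by apply/esym/maxI; [apply: (indF B) | rewrite subsetI sIB].
  exists B; split=> // B' B'M; rewrite leqNgt; apply/negP => lt.
  have [z [B2 [_ zB zF B2M sub]]] := bases_augment BM B'M lt.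
  have sF : z |: (B :&: F) \subset F by rewrite subUset sub1set zF subsetIr.
  have /maxI eq : (z |: (B :&: F) \in indep M) && (z |: (B :&: F) \subset F).
    by apply: (indF B2) => //; rewrite subsetI sub.
  have : z \in I by rewrite -eq ?setU11 // eI subsetUr.
  by rewrite eI inE (negPf zB).
case=> B [BM -> maxB]; apply/maxsetP; split.
  rewrite subsetIr andbT inE; apply/existsP; exists B.
  by rewrite BM subsetIl.
move=> J /andP[]; rewrite inE => /existsP[B' /andP[B'M sJ]] sJF sub.
apply/eqP; rewrite eq_sym eqEcard sub /=; apply: leq_trans (maxB _ B'M).
by apply: subset_leq_card; rewrite subsetI sJ.
Qed.

Fact deletion_exchange I1 I2 x : I1 \in deletion_bases ->
  I2 \in deletion_bases -> x \in I1 :\: I2 ->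
  exists2 y, y \in I2 :\: I1 & y |: (I1 :\ x) \in deletion_bases.
Proof.
case/deletion_basesP=> B1 [B1M -> max1] /deletion_basesP[B2 [B2M -> max2]].
set F := ground M :\: Y in max1 max2 *.
rewrite !in_setD !in_setI => /andP[+ /andP[xB1 xF]].
rewrite xF andbT => xB2.
suff [y [B [yB2 yB1 yF BM sub]]] : exists y B, [/\ y \in B2, y \notin B1, y \in F,
    B \in bases M & y |: (B1 :&: F :\ x) \subset B].
  exists y; first by rewrite !in_setD !in_setI yB2 yF (negPf yB1).
  have eqB : y |: (B1 :&: F :\ x) = B :&: F.
    apply/eqP; rewrite eqEcard; apply/andP; split.
      rewrite subsetI sub subUset sub1set yF /=.
      by apply: subset_trans (subD1set _ _) (subsetIr _ _).
    apply: leq_trans (max1 _ BM) _.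
    rewrite cardsU1 in_setD1 in_setI (negPf yB1) andbF.
    by rewrite [in leqLHS](cardsD1 x) in_setI xB1 xF.
  apply/deletion_basesP; exists B; split=> // B' B'M.
  rewrite -/F -eqB; apply: leq_trans (max1 _ B'M) _.
  rewrite cardsU1 in_setD1 in_setI (negPf yB1) andbF.
  by rewrite [in leqLHS](cardsD1 x) in_setI xB1 xF.
have xD : x \in B1 :\: B2 by rewrite inE xB2.
have [y yD BM] := bases_exchange B1M B2M xD.
have [yB1 yB2] : y \notin B1 /\ y \in B2 by move: yD; rewrite inE => /andP.
case yF: (y \in F).
  exists y, (y |: (B1 :\ x)); split=> //.
  by apply: setUS; apply: setSD; apply: subsetIl.
have capE : (y |: (B1 :\ x)) :&: F = B1 :&: F :\ x.
  apply/setP=> t; rewrite in_setI in_setU1 !in_setD1 in_setI.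
  case: (eqVneq t y) => [->|_] /=; first by rewrite yF (negPf yB1) !andbF.
  by rewrite andbA.
have [|z [B [zB2 zB zF B'M sub]]] := bases_augment (F := F) BM B2M.
  rewrite capE; apply: leq_trans (max2 _ B1M).
  by rewrite [in leqRHS](cardsD1 x) in_setI xB1 xF.
rewrite capE in sub; exists z, B; split=> //.
apply: contraNN zB => zB1; rewrite !inE zB1 andbT; apply/orP; right.
by apply: contraNneq xB2 => <-.
Qed.

Definition deletion : matroid T :=
  Matroid deletion_ground deletion_neq0 deletion_exchange.

End Deletion.

End MatroidFacts.

Definition contraction (T : finType) (M : matroid T) (X : {set T}) : matroid T :=
  dual (deletion (dual M) X).

Definition matroid_iso (T T' : finType) (M : matroid T) (M' : matroid T') : Prop :=
  exists f : T -> T',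
    [/\ {in ground M &, injective f},
        f @: ground M = ground M' &
        forall B : {set T}, B \subset ground M ->
          (B \in bases M) = (f @: B \in bases M')].

Definition has_minor (T T' : finType) (M : matroid T) (N : matroid T') : Prop :=
  exists X Y : {set T},
    [/\ X \subset ground M, Y \subset ground M, [disjoint X & Y] &
        matroid_iso (deletion (contraction M X) Y) N].

Lemma deletion0 (T : finType) (M : matroid T) :
  bases (deletion M set0) = bases M.
Proof.
have capE B : B \in bases M -> B :&: (ground M :\: set0) = B.
  by move=> /bases_ground /setIidPl; rewrite setD0.
apply/setP=> I; apply/deletion_basesP/idP => [[B [BM -> _]]|IM].
  by rewrite capE.
exists I; split=> // [|B BM]; first by rewrite capE.
by rewrite (capE _ BM) (capE _ IM); apply: bases_leq BM IM.
Qed.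

Lemma has_minor_refl (T : finType) (M : matroid T) : has_minor M M.
Proof.
exists set0, set0; split; rewrite ?sub0set //.
  by rewrite -setI_eq0 set0I.
exists id; split=> //; first by rewrite imset_id /= !setD0.
move=> B _; rewrite imset_id deletion0.
have DD A : A \in bases M -> ground M :\: (ground M :\: A) = A.
  by move=> AM; rewrite setDDr setDv set0U; apply/setIidPr/bases_ground.
have groundE : ground (deletion (dual M) set0) = ground M by rewrite /= setD0.
apply/imsetP/idP => [[A + ->]|BM].
  by rewrite deletion0 groundE => /imsetP[A' A'M ->]; rewrite DD.
exists (ground M :\: B); last by rewrite groundE DD.
by rewrite deletion0; apply: imset_f.
Qed.

Definition step : finType := bool.
Definition stepN : step := true.
Definition stepE : step := false.

Definition lattice_path (m r : nat) : finType :=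
  {w : (m + r).-tuple step | count_mem stepN w == r}.

Section GeneralizedCatalan.
Variables m r : nat.
Implicit Types L Q : lattice_path m r.

Definition height L (i : nat) : nat := count_mem stepN (take i (val L)).

(* After i steps two paths lie on the same antidiagonal x + y = i, so L is
   above Q there exactly when its height is larger. *)
Definition never_above L Q : bool :=
  [forall i : 'I_(m + r).+1, height L i <= height Q i].

(* Steps, hence ground set elements, are numbered from 0 instead of 1. *)
Definition Nsteps L : {set 'I_(m + r)} :=
  [set j | tnth (val L) j == stepN].

Definition gcat_bases Q : {set {set 'I_(m + r)}} :=
  [set Nsteps L | L : lattice_path m r & never_above L Q].

Lemma heightE L i : i <= m + r -> height L i = #|[set j in Nsteps L | j < i]|.
Proof.
move=> le_i; rewrite /height -[tval (val L)]map_tnth_enum -map_take count_map.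
have -> : take i (enum 'I_(m + r)) =
    [seq j : 'I_(m + r) <- enum 'I_(m + r) | j < i].
  apply: (inj_map val_inj); rewrite map_take -(filter_map val (fun j => j < i)).
  rewrite val_enum_ord take_iota (minn_idPl le_i).
  exact/esym/(filter_iota_ltn 0 le_i).
rewrite cardE -size_filter -filter_predI enumT; congr size.
apply: eq_filter => j /=.
by rewrite !inE andbC.
Qed.

Lemma gcat_basesP Q (B : {set 'I_(m + r)}) :
  reflect (#|B| = r /\
           forall i, i <= m + r -> #|[set j in B | j < i]| <= height Q i)
          (B \in gcat_bases Q).
Proof.
have NE L : #|Nsteps L| = r.
  have := heightE L (leqnn _).
  rewrite /height take_oversize ?size_tuple //
    (eqP (valP L)) => e; apply: etrans (esym e).
  by apply: eq_card => j; rewrite inE ltn_ord andbT.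
apply: (iffP imsetP) => [[L] | [cardB leB]].
  rewrite inE => /forallP leL ->; split=> // i le_i.
  by rewrite -heightE //; apply: (leL (Ordinal (le_i : i < (m + r).+1))).
pose w : (m + r).-tuple step := [tuple j \in B | j < m + r].
have wr : count_mem stepN w == r.
  apply/eqP; apply: etrans cardB.
  rewrite cardE -[tval w]map_tnth_enum count_map -size_filter enumT.
  congr size; apply: eq_filter => j /=.
  by rewrite tnth_mktuple; case: (j \in B).
pose L : lattice_path m r := Sub w wr.
have BE : B = Nsteps L.
  by apply/setP=> j; rewrite inE tnth_mktuple; case: (j \in B).
exists L => //; rewrite inE; apply/forallP=> i.
have le_i : i <= m + r by rewrite -ltnS.
by rewrite heightE // -BE; apply: leB.
Qed.

Fact gcat_ground Q B : B \in gcat_bases Q -> B \subset [set: 'I_(m + r)].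
Proof. by rewrite subsetT. Qed.

Fact gcat_neq0 Q : gcat_bases Q != set0.
Proof.
apply/set0Pn; exists (Nsteps Q); apply: imset_f.
by rewrite inE; apply/forallP.
Qed.

Fact gcat_exchange Q B1 B2 x : B1 \in gcat_bases Q -> B2 \in gcat_bases Q ->
  x \in B1 :\: B2 ->
  exists2 y, y \in B2 :\: B1 & y |: (B1 :\ x) \in gcat_bases Q.
Proof.
move=> /gcat_basesP[c1 le1] /gcat_basesP[c2 le2] xD.
have [xB2 xB1] : x \notin B2 /\ x \in B1 by move: xD; rewrite inE => /andP.
have cE y : y \in B2 :\: B1 -> #|y |: (B1 :\ x)| = r.
  rewrite inE => /andP[yB1 _]; rewrite cardsU1 in_setD1 (negPf yB1) andbF.
  by apply: etrans c1; rewrite [in RHS](cardsD1 x) xB1.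
have [y0 y0D] : exists y, y \in B2 :\: B1.
  apply/set0Pn; rewrite -card_gt0.
  have : #|B1 :&: B2| + #|B1 :\: B2| = #|B1 :&: B2| + #|B2 :\: B1|.
    by rewrite cardsID c1 setIC cardsID c2.
  by move/addnI <-; rewrite card_gt0; apply/set0Pn; exists x.
case: (@arg_maxnP _ y0 [pred j in B2 :\: B1] val y0D) => y /= yD maxy.
exists y => //; apply/gcat_basesP; split=> [|i le_i]; first exact: cE.
have [lt_xi | le_ix] := ltnP x i.
  apply: leq_trans (le1 i le_i).
  rewrite [in leqRHS](cardsD1 x) inE xB1 lt_xi.
  rewrite (cardsD1 y); apply: leq_add; first exact: leq_b1.
  apply: subset_leq_card; apply/subsetP=> t; rewrite !inE.
  by case/and3P=> /negPf-> /= /andP[-> ->] ->.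
have [le_iy | lt_yi] := leqP i y.
  apply: leq_trans (le1 i le_i).
  apply: subset_leq_card; apply/subsetP=> t; rewrite !inE.
  case/andP=> /orP[/eqP-> | /andP[_ ->] //].
  by rewrite ltnNge le_iy.
apply: leq_trans (le2 i le_i).
rewrite (cardsD1 y) inE setU11 lt_yi add1n.
have splitE (B : {set 'I_(m + r)}) :
    #|B| = #|[set j in B | j < i]| + #|[set j in B | i <= j]|.
  rewrite -(cardsID [set j : 'I_(m + r) | j < i] B); congr (_ + _).
    by apply: eq_card => t; rewrite !inE.
  by apply: eq_card => t; rewrite !inE -leqNgt andbC.
have lt21 : #|[set j in B2 | i <= j]| < #|[set j in B1 | i <= j]|.
  apply: proper_card; apply/properP; split; last first.
    by exists x; rewrite inE ?xB1 // (negPf xB2).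
  apply/subsetP=> t; rewrite !inE => /andP[tB2 le_it]; rewrite le_it andbT.
  apply: contraLR le_it => tB1; rewrite -ltnNge; apply: leq_ltn_trans lt_yi.
  by apply: maxy; rewrite inE tB1.
apply: (@leq_ltn_trans #|[set j in B1 | j < i]|).
  apply: subset_leq_card; apply/subsetP=> t; rewrite !inE.
  by case/and3P=> /negPf-> /= /andP[_ ->] ->.
have e12 : #|B1| = #|B2| by rewrite c1 c2.
rewrite -(ltn_add2r #|[set j in B1 | i <= j]|) -splitE e12 (splitE B2).
by rewrite ltn_add2l.
Qed.

Definition gcat_matroid Q : matroid 'I_(m + r) :=
  Matroid (@gcat_ground Q) (gcat_neq0 Q) (@gcat_exchange Q).

End GeneralizedCatalan.

Definition kcat_word (k : nat) : seq step := flatten (nseq k [:: stepN; stepE]).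

Fact kcat_size k : size (kcat_word k) == k + k.
Proof. by elim: k => //= k IH; rewrite (eqP IH) addSn addnS. Qed.

Fact kcat_count k : count_mem stepN (Tuple (kcat_size k)) == k.
Proof. by rewrite /=; elim: k => //= k /eqP ->. Qed.

Definition kcat_path (k : nat) : lattice_path k k :=
  exist _ (Tuple (kcat_size k)) (kcat_count k).

Definition kcat_matroid (k : nat) : matroid 'I_(k + k) :=
  gcat_matroid (kcat_path k).

Section Graphs.
Variables (V : finType) (e : rel V).

Definition edges : {set {set V}} :=
  [set [set p.1; p.2] | p : V * V & e p.1 p.2].

Definition cycle_edges (c : seq V) : {set {set V}} :=
  [set [set v; next c v] | v in c].

(* Hamiltonian cycles are identified with their edge sets, so that rotations
   and reversals of a vertex sequence are not counted as distinct. *)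
Definition ham_cycles : {set {set {set V}}} :=
  [set cycle_edges c | c : #|V|.-tuple V & ucycleb e c && (2 < #|V|)].

Definition ham_cycles_through (eps : {set V}) : nat :=
  #|[set C in ham_cycles | eps \in C]|.

End Graphs.

Definition basis (T : finType) (M : matroid T) : finType :=
  {B : {set T} | B \in bases M}.

Definition basis_graph (T : finType) (M : matroid T) : rel (basis M) :=
  fun B B' => #|(val B :\: val B') :|: (val B' :\: val B)| == 2.

Definition HC (T : finType) (M : matroid T) (eps : {set basis M}) : nat :=
  ham_cycles_through (@basis_graph T M) eps.

(* The initial value of the big operator bounds every HC eps from above, so
   this is the minimum as soon as there is an edge; without edges it is 0. *)
Definition HCstar (T : finType) (M : matroid T) : nat :=
  \big[minn/#|ham_cycles (@basis_graph T M)|]_(eps in edges (@basis_graph T M))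
     HC eps.

Lemma HCstarP (T : finType) (M : matroid T) :
  edges (@basis_graph T M) != set0 ->
  exists2 eps, eps \in edges (@basis_graph T M) &
    HCstar M = HC eps /\
    forall eps', eps' \in edges (@basis_graph T M) -> HC eps <= HC eps'.
Proof.
set E := edges _ => /set0Pn[eps0 eps0E].
case: (@arg_minnP _ eps0 (mem E) (@HC T M) eps0E) => eps epsE minE.
exists eps => //; split=> //; apply/eqP; rewrite eqn_leq; apply/andP; split.
  have: eps \in [seq e <- index_enum _ | e \in E].
    by rewrite mem_filter mem_index_enum andbT; apply: epsE.
  rewrite /HCstar -big_filter -/E; elim: [seq e <- _ | _] => // a s IH.
  rewrite in_cons big_cons => /predU1P[<-|/IH]; first exact: geq_minl.
  by apply: leq_trans; apply: geq_minr.
apply: (big_ind (fun n => HC eps <= n)) => [|a b ha hb|e /minE //].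
  by apply: subset_leq_card; apply/subsetP=> C; rewrite inE => /andP[].
by rewrite leq_min ha hb.
Qed.

Definition hcl_value (k n : nat) : Prop :=
  exists (m r : nat) (Q : lattice_path m r),
    has_minor (gcat_matroid Q) (kcat_matroid k) /\ n = HCstar (gcat_matroid Q).

Lemma hcl_value_ex k : exists n, `[< hcl_value k n >].
Proof.
exists (HCstar (kcat_matroid k)); apply/asboolP.
by exists k, k, (kcat_path k); split=> //; apply: has_minor_refl.
Qed.

Definition hcl (k : nat) : nat := ex_minn (hcl_value_ex k).

Definition sf (x : nat) : nat := \prod_(i < x.+1) i`!.

(* Main.v *)
Require Import Defs.
From mathcomp Require Import all_boot.
From mathcomp Require Import zify.

(** Hamiltonian cycles through an edge uv correspond to Hamiltonian paths from
    u to v. The bases of M[Q], written as words, split by their first letter: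
    for Q = N^(b+1) E R the words starting with N form the basis graph of
    N^b E R and those starting with E the one of N^(b+1) R. Hamiltonian paths of
    the two halves can always be glued, so that, h(Q) being the least number of
    Hamiltonian paths between adjacent vertices,
    h(N^(b+1) E R) >= h(N^b E R) * h(N^(b+1) R). A path N^b E N^c gives a complete
    graph on b+1 vertices, hence h = (b-1)!; unfolding the recursion gives
    sf(b + i) when Q starts with N^b and has at least i + 2 corners NE, and
    sf(k - 1) sf(k - 2) when it has at least k >= 2 corners.

    A k-Catalan minor forces k corners: in the k-Catalan matroid the basis of
    all N steps of (NE)^k has elements a_i and non-elements c_j such that
    exchanging a_i for c_j gives a basis iff i <= j. This pattern lifts from
    minors, and in M[Q] the failing exchanges (j < i) yield points where the
    path of the basis touches Q, with a corner of Q between consecutive ones. *)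

Set Implicit Arguments.
Unset Strict Implicit.
Unset Printing Implicit Defensive.

(** * Words below a path *)

(* [true] is a step N, [false] a step E. *)
Notation word := (seq bool).

(* [y] arises from [x] by turning one E into N. *)
Fixpoint up (x y : word) : bool :=
  match x, y with
  | a :: x', b :: y' => if a == b then up x' y' else ~~ a && (x' == y')
  | _, _ => false
  end.

Fixpoint adj (x y : word) : bool :=
  match x, y with
  | a :: x', b :: y' =>
      if a == b then adj x' y' else if a then up x' y' else up y' x'
  | _, _ => false
  end.

(* The first N is turned into E; the result is always legal with one unit of
   slack less, see [dom_low]. *)
Fixpoint low (y : word) : word :=
  match y with
  | true :: y' => false :: y'
  | false :: y' => false :: low y'
  | [::] => [::]
  end.

(* [w] has [d] more N steps than [Q] and at each prefix at most [d] more. *)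
Fixpoint dom (d : nat) (w Q : word) : bool :=
  match w, Q with
  | [::], [::] => d == 0
  | c :: w', t :: Q' => (c <= d + t) && dom (d + t - c) w' Q'
  | _, _ => false
  end.

Lemma adjC x y : adj x y = adj y x.
Proof. by elim: x y => [|[] x IH] [|[] y] //=; apply: IH. Qed.

Lemma adjxx x : adj x x = false.
Proof. by elim: x => //= a x; rewrite eqxx. Qed.

(** The raised positions differ, so each of [y] and [y'] has an N exactly where the other keeps the
    E. *)
Lemma up_adj_above x y y' : up x y -> up x y' -> y != y' -> adj y y'.
Proof.
elim: x y y' => [|[] x IH] [|[] y] [|[] y'] //=.
- by rewrite eqseq_cons eqxx; apply: IH.
- by move=> /eqP<- /eqP<-; rewrite eqxx.
- by move=> /eqP<-.
- by move=> + /eqP<-.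
- by rewrite eqseq_cons eqxx; apply: IH.
Qed.

Lemma up_adj_below x x' y : up x y -> up x' y -> x != x' -> adj x x'.
Proof.
elim: y x x' => [|[] y IH] [|[] x] [|[] x'] //=.
- by rewrite eqseq_cons eqxx; apply: IH.
- by move=> + /eqP->.
- by move=> /eqP->.
- by move=> /eqP-> /eqP->; rewrite eqxx.
- by rewrite eqseq_cons eqxx; apply: IH.
Qed.

Lemma up_ex x : 0 < count_mem false x -> exists y, up x y.
Proof.
elim: x => //= -[] x IH /= H; last by exists (true :: x) => /=.
by have [y] := IH H; exists (true :: y).
Qed.

Lemma up_ex_neq x y : up x y -> 1 < count_mem false x ->
  exists2 y', up x y' & y != y'.
Proof.
elim: x y => [|[] x IH] [|[] y] //=.
- by rewrite !add0n => /IH{}IH /IH[y' ? ?]; exists (true :: y').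
- by move=> /eqP<- /up_ex[y' ?]; exists (false :: y').
- by move=> _ _; exists (true :: x) => /=.
Qed.

Lemma up_count x y : up x y -> count_mem false x = (count_mem false y).+1.
Proof.
elim: x y => [|[] x IH] [|[] y] //=.
- by move/IH->.
- by move/eqP->.
- by move/IH->.
Qed.

Lemma adj_count x y : adj x y -> count_mem false x = count_mem false y.
Proof.
elim: x y => [|[] x IH] [|[] y] //=.
- exact: IH.
- by move/up_count->.
- by move/up_count->.
- by move/IH->.
Qed.

Lemma adj_count_gt0 x y : adj x y -> 0 < count_mem false x.
Proof.
elim: x y => [|[] x IH] [|[] y] //=.
- exact: IH.
- by move/up_count->.
Qed.

Lemma up_low y : true \in y -> up (low y) y.
Proof. by elim: y => [|[] y IH] //=; rewrite ?eqxx // inE. Qed.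

Lemma up_has_true x y : up x y -> true \in y.
Proof.
elim: x y => [|[] x IH] [|[] y] //=.
by move/IH; rewrite inE => ->.
Qed.

(** [x'] arises from [x] by raising one E and lowering one N. If [y] raises that same E, then [y] is
    above [x'] too; otherwise the E raised in [y] can also be raised in [x'], which gives a
    neighbour of [y]. *)
Lemma adj_up x x' y : adj x x' -> up x y ->
  up x' y \/ exists2 y', up x' y' & adj y y'.
Proof.
elim: x x' y => [|[] x IH] [|[] x'] [|[] y] //=.
- move=> a u; have [|[y' ? ?]] := IH _ _ a u; first by left.
  by right; exists (true :: y').
- move=> u' u; have [->|neq] := eqVneq x' y; first by left.
  by right; exists (true :: x') => //=; apply: up_adj_above u u' _; rewrite eq_sym.
- by move=> ux /eqP<-; left.
- by move=> ux uy; right; exists (true :: x).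
- by move=> a /eqP<-; right; exists (true :: x') => /=.
move=> a u; right; have [u'|[y' ? ?]] := IH _ _ a u.
  by exists (true :: x') => /=.
by exists (false :: y').
Qed.

(** With a second E available, the case where [y] itself is above [x'] is resolved by choosing
    another word above [x']. *)
Lemma adj_up_ex x x' y : adj x x' -> up x y -> 1 < count_mem false x ->
  exists2 y', up x' y' & adj y y'.
Proof.
move=> a u c; have [u'|//] := adj_up a u.
have [y' ? ?] := up_ex_neq u' (leq_trans c (eq_leq (adj_count a))).
by exists y' => //; apply: up_adj_above u' _ _.
Qed.

Lemma adj_up1 x x' y : adj x x' -> up x y -> count_mem false x = 1 -> up x' y.
Proof.
move=> a u c; have [//|[y' u' /adj_count_gt0]] := adj_up a u.
by move: c; rewrite (up_count u) => -[->].
Qed.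

(** The critical case is that only one word starts with N: the remainders of the two lowered words
    then lie below a common word, so they coincide or [up_adj_below] applies. *)
Lemma adj_low y y' : adj y y' -> low y = low y' \/ adj (low y) (low y').
Proof.
have key x y0 : up x y0 -> x = low y0 \/ adj x (low y0).
  move=> u; have [->|neq] := eqVneq x (low y0); first by left.
  right; apply: up_adj_below u (up_low (up_has_true u)) neq.
elim: y y' => [|[] y IH] [|[] y'] //=.
- by right.
- by move/key=> [->|?]; [left|right].
- by rewrite adjC; move/key=> [->|?]; [left|right].
- by move/IH=> [->|?]; [left|right].
Qed.

Lemma dom_up d x y Q : dom d x Q -> up x y -> dom d.+1 y Q.
Proof.
elim: Q d x y => [|t Q IH] d [|a x] [|b y] //= /andP[le_a D].
have [<-|neq] := eqVneq a b.
  by move/(IH _ _ _ D); rewrite addSn subSn // leqW.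
case: a b neq le_a D => [] [] //= _ _ D /eqP<-.
by rewrite addSn subSS.
Qed.

(** Prefixes ending before the first N contain no N at all, and all later ones lose an N. *)
Lemma dom_low d y Q : dom d.+1 y Q -> dom d (low y) Q.
Proof.
elim: Q d y => [|t Q IH] d [|[] y] //=.
by rewrite !subn0 addSn => /IH.
Qed.

Lemma dom_size d w Q : dom d w Q -> size w = size Q.
Proof. by elim: Q d w => [|t Q IH] d [|a w] //= /andP[_ /IH->]. Qed.

Lemma dom_count d w Q : dom d w Q -> count_mem true w = d + count_mem true Q.
Proof.
elim: Q d w => [|t Q IH] d [|a w] //=; first by move/eqP->.
by move=> /andP[+ /IH->]; case: a; case: t => /=; lia.
Qed.

Lemma dom_has_true d y Q : dom d.+1 y Q -> true \in y.
Proof. by move/dom_count; rewrite -has_pred1 has_count => ->. Qed.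

Lemma dom_refl Q : dom 0 Q Q.
Proof. by elim: Q => //= t Q IH; rewrite add0n leqnn subnn. Qed.

Lemma count_false_true (w : word) :
  count_mem false w + count_mem true w = size w.
Proof. by elim: w => //= -[] w /=; lia. Qed.

Lemma dom_count_false d w w' Q :
  dom d w Q -> dom d w' Q -> count_mem false w = count_mem false w'.
Proof.
move=> D D'; have := count_false_true w; have := count_false_true w'.
by rewrite (dom_count D) (dom_count D') (dom_size D) (dom_size D'); lia.
Qed.

Lemma count_false_eq0 (w : word) : count_mem false w = 0 -> w = nseq (size w) true.
Proof. by elim: w => //= -[] w //= IH /IH{1}->. Qed.

Lemma dom_single d w y Q : count_mem false y = 0 ->
  dom d y Q -> dom d w Q -> w = y.
Proof.
move=> y0 Dy Dw; rewrite (count_false_eq0 y0).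
rewrite (count_false_eq0 (_ : count_mem false w = 0)).
  by rewrite (dom_size Dy) (dom_size Dw).
by rewrite (dom_count_false Dw Dy).
Qed.

(* Together with the first-letter decomposition this identifies the words
   below N^(b+1) E Q starting with E with the words below N^(b+1) Q. *)
Lemma dom_shift d w b Q :
  dom d.+1 w (nseq b true ++ false :: Q) = dom d w (nseq b true ++ true :: Q).
Proof.
elim: b d w => [|b IH] d [|c w] //=; first by rewrite addn0 addn1.
rewrite !addn1; case: c; last by rewrite !subn0 IH.
by rewrite /= !subSS !subn0 IH.
Qed.

(** Without slack the first letter is forced to be E and the question passes to the tail. With slack
    the first letter can be switched and compensated later: an E by lowering an N, an N by raising
    an E. This fails only for the word without any E. *)
Lemma neighbour_or_single d x Q : dom d x Q ->
  (exists2 x', dom d x' Q & adj x x') \/ (forall w, dom d w Q -> w = x).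
Proof.
elim: Q d x => [|t Q IH] d [|a x] //=.
  by move=> _; right=> -[].
case ds: (d + t) => [|s].
  case: a => //=; rewrite subn0 => D; have [[x' D' a']|S] := IH _ _ D.
    by left; exists (false :: x') => //=; rewrite ds subn0.
  by right=> -[|[] w] //=; rewrite ds //= subn0 => /S->.
case: a => /=; rewrite ?subn1 ?subn0 /= => D; last first.
  left; exists (true :: low x); rewrite /= ?ds ?subn1 ?(dom_low D) //.
  exact: up_low (dom_has_true D).
case: (posnP (count_mem false x)) => [x0|]; last first.
  move=> /up_ex[y uy]; left; exists (false :: y) => //=.
  by rewrite ds subn0; apply: dom_up D uy.
right=> -[|[] w] //=; rewrite ds ?subn1 ?subn0 /= => Dw.
  by rewrite (dom_single x0 D Dw).
have := count_false_true w; have := count_false_true x.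
by rewrite x0 (dom_size D) (dom_size Dw) (dom_count D) (dom_count Dw); lia.
Qed.

(** * Gluing Hamiltonian paths *)

Definition hampath (V : pred word) (u v : word) (p : seq word) : Prop :=
  [/\ ohead p = Some u, last u p = v, sorted adj p, uniq p & p =i V].

(* A single vertex counts as linked to itself by its one-vertex Hamiltonian
   path; this is what makes the product bound hold without exceptions. *)
Definition linked (V : pred word) (u v : word) : Prop :=
  [/\ V u, V v & adj u v \/ u = v /\ forall w, V w -> w = u].

Definition many_hampaths (n : nat) (V : pred word) : Prop :=
  forall u v, linked V u v ->
  exists L, [/\ uniq L, n <= size L & forall p, p \in L -> hampath V u v p].

Lemma many_hampathsW m n V : m <= n -> many_hampaths n V -> many_hampaths m V.
Proof.
by move=> le H u v /H[L [? le' ?]]; exists L; split=> //; apply: leq_trans le le'.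
Qed.

Lemma eq_hampath V V' u v p : V =1 V' -> hampath V u v p -> hampath V' u v p.
Proof.
by move=> e [? ? ? ? i]; split=> // w; rewrite i; apply: e.
Qed.

Lemma eq_many_hampaths n V V' : V =1 V' -> many_hampaths n V -> many_hampaths n V'.
Proof.
move=> e H u v [uV vV d]; have [|L [? ? HL]] := H u v.
  split; rewrite ?e //.
  by case: d => [|[-> S]]; [left|right; split=> // w; rewrite e => /S].
by exists L; split=> // p /HL; apply: eq_hampath.
Qed.

(** The letter [c] is a parameter so that the roles of the two halves can be exchanged. *)
Definition splice (A B : pred word) (c : bool) (w : word) : bool :=
  if w is a :: w' then if a == c then A w' else B w' else false.

(** Recovers from a glued path its part in one half; gluing is thereby injective in the pieces. *)
Definition tails (c : bool) (p : seq word) : seq word :=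
  [seq behead w | w <- p & ohead w == Some c].

Lemma tails_cat c p q : tails c (p ++ q) = tails c p ++ tails c q.
Proof. by rewrite /tails filter_cat map_cat. Qed.

Lemma tails_map c p : tails c (map (cons c) p) = p.
Proof. by rewrite /tails; elim: p => //= x p IH; rewrite eqxx /= IH. Qed.

Lemma tails_mapN c p : tails c (map (cons (~~ c)) p) = [::].
Proof. by rewrite /tails; elim: p => //= x p IH; case: c IH. Qed.

Lemma tailsN_map c p : tails (~~ c) (map (cons c) p) = [::].
Proof. by rewrite -{2}[c]negbK tails_mapN. Qed.

Lemma sorted_adj_map c p : sorted adj (map (cons c) p) = sorted adj p.
Proof.
case: p => //= x p; rewrite path_map; apply: eq_path => y z /=.
by rewrite eqxx.
Qed.

Lemma mem_map_cons a c w (p : seq word) :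
  (a :: w \in map (cons c) p) = (a == c) && (w \in p).
Proof.
apply/mapP/andP => [[y yp [-> ->]]|[/eqP-> wp]]; first by rewrite eqxx.
by exists w.
Qed.

Lemma nil_map_cons c (p : seq word) : ([::] \in map (cons c) p) = false.
Proof. by elim: p. Qed.

Lemma cons_inj (c : bool) : injective (cons c : word -> word).
Proof. by move=> x y []. Qed.

Lemma hampath_cat A B c u u' v v' p q :
  hampath A u u' p -> hampath B v' v q -> adj (c :: u') (~~ c :: v') ->
  hampath (splice A B c) (c :: u) (~~ c :: v)
    (map (cons c) p ++ map (cons (~~ c)) q).
Proof.
case: p => [[]//|_ p [[->] lp sp up' mp]].
case: q => [[]//|_ q [[->] lq sq uq mq]] ad; rewrite /= in lp lq; split=> //.
- by rewrite last_cat /= last_map -lq.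
- rewrite /= cat_path path_map last_map lp /=; apply/and3P; split=> //.
    by move: sp; rewrite /= (@eq_path _ _ adj) // => y z /=; rewrite eqxx.
  by rewrite path_map; move: sq;
     rewrite /= (@eq_path _ _ adj) // => y z /=; rewrite eqxx.
- rewrite cat_uniq !map_inj_uniq ?up' ?uq ?andbT //; try exact: cons_inj.
  apply/hasPn=> _ /mapP[y _ ->].
  by rewrite -[X in ~~ X]/(_ \in map _ (u :: p)) mem_map_cons; case: (c).
- case=> [|a w]; rewrite mem_cat ?nil_map_cons // !mem_map_cons mp mq.
  rewrite -[RHS]/(if a == c then A w else B w) -[w \in A]/(A w) -[w \in B]/(B w).
  by case: (a); case: (c); rewrite /= ?orbF.
Qed.

(** The edge from [x] to [x'] is replaced by a detour that traverses the whole other half. *)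
Lemma hampath_insert A B c u u' v v' x x' s t q :
  hampath A u u' (s ++ x :: x' :: t) -> hampath B v v' q ->
  adj (c :: x) (~~ c :: v) -> adj (~~ c :: v') (c :: x') ->
  hampath (splice A B c) (c :: u) (c :: u')
    (map (cons c) (rcons s x) ++ map (cons (~~ c)) q ++ map (cons c) (x' :: t)).
Proof.
move=> [hp lp sp up' mp].
case: q => [[]//|_ q [[->] lq sq uq mq]] ad ad'; rewrite /= in lq.
(* Up to order the vertices are those of a plain concatenation, which settles uniqueness and
   covering. *)
have e : perm_eq
     (map (cons c) (rcons s x) ++ map (cons (~~ c)) (v :: q) ++ map (cons c) (x' :: t))
     (map (cons c) (s ++ x :: x' :: t) ++ map (cons (~~ c)) (v :: q)).
  rewrite -cat_rcons [in X in perm_eq _ X]map_cat -catA perm_cat2l.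
  by rewrite perm_catC.
split=> //.
- by case: s hp {lp sp up' mp e} => [|y s] /= [->].
- by rewrite -lp !last_cat /= !last_map.
- have [y [s' [es l]]] : exists y s', rcons s x = y :: s' /\ last y s' = x.
    by case: s {hp lp sp up' mp e} => [|y s]; [exists x, [::]|exists y, (rcons s x);
       rewrite last_rcons].
  move: sp; rewrite -cat_rcons -(sorted_adj_map c) map_cat es /= !cat_path /= !cat_path /=.
  case/and3P=> -> _ ->; rewrite !last_map l lq ad ad' /= andbT.
  by move: sq; rewrite -(sorted_adj_map (~~ c)) /= => ->.
- rewrite (perm_uniq e) cat_uniq !map_inj_uniq ?up' ?uq ?andbT //;
    try exact: cons_inj.
  apply/hasPn=> _ /mapP[y _ ->].
  by rewrite -[X in ~~ X]/(_ \in map _ _) mem_map_cons; case: (c).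
- move=> w; rewrite (perm_mem e) mem_cat.
  case: w => [|a w]; rewrite ?nil_map_cons // !mem_map_cons mp mq.
  rewrite -[RHS]/(if a == c then A w else B w) -[w \in A]/(A w) -[w \in B]/(B w).
  by case: (a); case: (c); rewrite /= ?orbF.
Qed.

(** Fibres over distinct elements are disjoint, so their sizes add up. With [tails c] as [g], this
    lets the detour depend on the path into which it is inserted. *)
Lemma many_fibres (T U : eqType) (g : U -> T) (R : U -> Prop) n (s : seq T) :
  uniq s ->
  (forall x, x \in s -> exists K, [/\ uniq K, n <= size K &
     forall y, y \in K -> R y /\ g y = x]) ->
  exists K, [/\ uniq K, size s * n <= size K &
     forall y, y \in K -> R y /\ g y \in s].
Proof.
elim: s => [|x s IH] /=; first by exists [::]; split.
move=> /andP[xs us] H; have [|K [uK sK HK]] := IH us.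
  by move=> y ys; apply: H; rewrite inE ys orbT.
have [|K' [uK' sK' HK']] := H x; first exact: mem_head.
exists (K' ++ K); split=> [||y].
- rewrite cat_uniq uK uK' andbT; apply/hasPn=> y yK; apply/negP=> /HK'[_ e].
  by case: (HK _ yK); rewrite e (negPf xs).
- by rewrite size_cat mulSn leq_add.
- by rewrite mem_cat => /orP[/HK'[? ->]|/HK[? h]]; split=> //; rewrite inE ?eqxx ?h ?orbT.
Qed.

Lemma linked_sym V u v : linked V u v -> linked V v u.
Proof.
case=> uV vV [a|[e S]]; split=> //; first by left; rewrite adjC.
by right; rewrite -e.
Qed.

(** This is the case of two ends in the half [A]: every Hamiltonian path of [A] admits a detour
    through [B], and there are [n] ways to run through [B]. *)
Lemma splice_many_inner A B c m n u v :
  many_hampaths m A -> many_hampaths n B -> linked A u v ->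
  (forall p, hampath A u v p -> exists s x x' t, p = s ++ x :: x' :: t /\
     exists w w', [/\ adj (c :: x) (~~ c :: w), adj (~~ c :: w') (c :: x')
                    & linked B w w']) ->
  exists L, [/\ uniq L, m * n <= size L &
    forall p, p \in L -> hampath (splice A B c) (c :: u) (c :: v) p].
Proof.
move=> HA HB luv C; have [L [uL sL HL]] := HA _ _ luv.
have [p pL|K [uK sK HK]] := @many_fibres _ _ (tails c)
   (hampath (splice A B c) (c :: u) (c :: v)) n L uL; last first.
  exists K; split=> // [|p /HK[]//].
  by apply: leq_trans sK; rewrite leq_mul2r sL orbT.
have hp := HL p pL; have [s [x [x' [t [e [w [w' [a a' l]]]]]]]] := C p hp.
have [Lq [uq sq Hq]] := HB _ _ l.
pose ins q := map (cons c) (rcons s x) ++ map (cons (~~ c)) q ++ map (cons c) (x' :: t).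
have insK : cancel ins (tails (~~ c)).
  by move=> q; rewrite /ins !tails_cat tails_map !tailsN_map cats0.
exists (map ins Lq); split.
- by rewrite map_inj_uniq //; apply: can_inj insK.
- by rewrite size_map.
- move=> _ /mapP[q qL ->]; split.
    by apply: hampath_insert a a' => //; [rewrite -e|apply: Hq].
  by rewrite /ins !tails_cat tails_mapN !tails_map e cat_rcons.
Qed.

(** This is the case of ends in different halves: the crossing edge is fixed in advance, so the two
    pieces vary independently. *)
Lemma splice_many_cross A B c m n u u' v v' :
  many_hampaths m A -> many_hampaths n B ->
  linked A u u' -> linked B v' v -> adj (c :: u') (~~ c :: v') ->
  exists L, [/\ uniq L, m * n <= size L &
    forall p, p \in L -> hampath (splice A B c) (c :: u) (~~ c :: v) p].
Proof.
move=> HA HB lu lv a.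
have [L [uL sL HL]] := HA _ _ lu; have [K [uK sK HK]] := HB _ _ lv.
exists [seq map (cons c) p ++ map (cons (~~ c)) q | p <- L, q <- K]; split.
- apply: allpairs_uniq => // -[p q] [p' q'] _ _ /= e.
  congr (_, _); first by have := congr1 (tails c) e;
    rewrite !tails_cat !tails_map !tails_mapN !cats0.
  have := congr1 (tails (~~ c)) e; rewrite !tails_cat !tails_map.
  by rewrite !tailsN_map.
- by rewrite size_allpairs leq_mul.
- move=> _ /allpairsP[[p q] /= [/HL hp /HK hq ->]]; exact: hampath_cat hp hq a.
Qed.

Lemma split_at_change (T S : eqType) (f : T -> S) (x : T) (p : seq T) :
  (exists s y y' t, x :: p = s ++ y :: y' :: t /\ f y != f y')
  \/ {in x :: p, forall y, f y = f x}.
Proof.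
elim: p x => [|x' p IH] x; first by right=> y; rewrite inE => /eqP->.
have [e|ne] := eqVneq (f x) (f x'); last by left; exists [::], x, x', p.
case: (IH x') => [[s [y [y' [t [-> ne]]]]]|H].
  by left; exists (x :: s), y, y', t.
right=> y; rewrite inE => /predU1P[->//|/H->]; exact: esym.
Qed.

(** * Gluing the words that start with N to those that start with E *)

Section Step.
Variables (s : nat) (T : word).
(** [A] and [B] hold the remainders after a first letter N and E respectively; the crossing edges
    are the pairs related by [up]. *)
Let A : pred word := dom s ^~ T.
Let B : pred word := dom s.+1 ^~ T.

(** If [z] has two E's, [adj_up_ex] applies. If it has one, the word above it is all N; it is then
    the only vertex of [B] and lies above [z'] as well. *)
Lemma linked_up z z' : A z -> A z' -> adj z z' ->
  exists w w', [/\ up z w, up z' w' & linked B w w'].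
Proof.
move=> Az Az' a; have [w zw] := up_ex (adj_count_gt0 a).
have Bw : B w := dom_up Az zw; exists w.
have [c1|c1] := ltnP 1 (count_mem false z).
  have [w' z'w' aw] := adj_up_ex a zw c1; exists w'; split=> //.
  by split=> //; [apply: dom_up Az' z'w'|left].
have c0 : count_mem false w = 0 by move: c1; rewrite (up_count zw) ltnS leqn0 => /eqP.
exists w; split=> //; first by apply: (adj_up1 a zw); rewrite (up_count zw) c0.
by split=> //; right; split=> // w'; apply: dom_single.
Qed.

(** A glued path from [x] to [y] has to exhaust each half before or after crossing, so the crossing
    edge must avoid [x] and [y] unless their half is a single vertex. *)
Lemma linked_cross x y : A x -> B y -> up x y ->
  exists x' y', [/\ linked A x x', linked B y' y & up x' y'].
Proof.
move=> Ax By u; have [c1|c1] := ltnP 1 (count_mem false x).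
  have [[x' Ax' a]|S] := neighbour_or_single Ax.
    have [y' u' a'] := adj_up_ex a u c1; exists x', y'; split=> //.
      by split=> //; left.
    by split=> //; [apply: dom_up Ax' u'|left; rewrite adjC].
  have [y' u' ne] := up_ex_neq u c1; exists x, y'; split=> //.
    by split=> //; right.
  split=> //; first exact: dom_up Ax u'.
  by left; rewrite adjC; apply: up_adj_above u u' ne.
have c0 : count_mem false y = 0 by move: c1; rewrite (up_count u) ltnS leqn0 => /eqP.
have lB : linked B y y by split=> //; right; split=> // w; apply: dom_single.
have [[x' Ax' a]|S] := neighbour_or_single Ax.
  exists x', y; split=> //; first by split=> //; left.
  by apply: (adj_up1 a u); rewrite (up_count u) c0.
by exists x, y; split=> //; split=> //; right.
Qed.

Lemma low_up y : B y -> up (low y) y.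
Proof. by move=> By; apply: up_low (dom_has_true By). Qed.

(** A word [z] of [A] starting with E is the lowering of the same word started with N. One starting
    with N has two E's, and raising them separately gives words of [B] with different lowerings. *)
Lemma low_constant y0 z : 0 < count_mem false y0 -> B y0 ->
  (forall y, B y -> low y = low y0) -> A z -> z = low y0.
Proof.
move=> c By0 C Az; case: z Az => [|[] z] Az.
- by have := dom_size By0; rewrite -(dom_size Az); case: (y0) c.
- have c1 : 1 < count_mem false (true :: z).
    by rewrite (dom_count_false Az (dom_low By0)) (up_count (low_up By0)).
  have [w u] : exists w, up z w by apply: up_ex; apply: ltnW.
  have [w' u' ne] := up_ex_neq u c1.
  have Bu v : up z v -> low (true :: v) = low y0.
    by move=> uv; apply: C; apply: (dom_up Az).
  have [e] : false :: w = false :: w' by rewrite -[LHS]/(low (true :: w)) Bu // -(Bu w').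
  by rewrite e eqxx in ne.
- have u : up (false :: z) (true :: z) by rewrite /=.
  by rewrite -(C _ (dom_up Az u)).
Qed.

(** If [low] changes along the path, the lowerings at a change are adjacent. If it is constant, [A]
    is a single vertex by [low_constant], and any edge of the path will do. *)
Lemma linked_low y y' p : adj y y' -> hampath B y y' p ->
  exists s w w' t, p = s ++ w :: w' :: t /\
     exists z z', [/\ up z w, up z' w' & linked A z z'].
Proof.
move=> a; case: p => [[]//|_ p] [[->] lp sp uq mp].
have inB w : w \in y :: p -> B w by rewrite mp.
have By : B y by apply: inB; exact: mem_head.
have [[s' [w [w' [t [e ne]]]]]|C] := split_at_change low y p.
  have [Bw Bw'] : B w /\ B w' by split; apply: inB; rewrite e mem_cat !inE eqxx ?orbT.
  exists s', w, w', t; split=> //; exists (low w), (low w').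
  split; try exact: low_up; split; try exact: dom_low.
  left; move: sp; rewrite e => /cat_sorted2[_ /= /andP[/adj_low[e'|//] _]].
  by rewrite e' eqxx in ne.
case: p lp sp uq mp inB C => [|w' t] /= lp sp uq mp inB C.
  by rewrite -lp adjxx in a.
have Bw' : B w' by apply: inB; rewrite !inE eqxx orbT.
exists [::], y, w', t; split=> //; exists (low y), (low y).
have e : low w' = low y by apply: C; rewrite !inE eqxx orbT.
split; [exact: low_up|by rewrite -e; exact: low_up|].
split; try exact: dom_low; right; split=> // z; apply: low_constant By _.
  exact: adj_count_gt0 a.
by move=> w Bw; apply: C; rewrite mp.
Qed.

Lemma many_hampaths_step m n y : B y ->
  many_hampaths m A -> many_hampaths n B -> many_hampaths (m * n) (splice A B true).
Proof.
move=> By HA HB.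
have eqAB : splice B A false =1 splice A B true by case=> [|[]].
have HAB := splice_many_inner (c := true) HA HB.
have HBA := splice_many_inner (c := false) HB HA.
case=> [|a u] [|b v] [] // uV vV [d|[_ S]]; last first.
  (* The single-vertex alternative is void, since words with either first letter occur. *)
  have := S (true :: low y) (dom_low By); have := S (false :: y) By.
  by move=> <-.
case: a b uV vV d => [] [] /= uV vV d.
(* Both ends start with N: the detour can leave right after the first vertex. *)
- apply: HAB => [|p]; first by split=> //; left.
  case: p => [[]//|_ [|x p]] [[->] /= lp sp _ mp].
    by rewrite -lp adjxx in d.
  case/andP: sp => ax _.
  have Ax : A x by rewrite -[A x]mp !inE eqxx orbT.
  have [w [w' [uw uw' l]]] := linked_up uV Ax ax.
  by exists [::], u, x, p; split=> //; exists w, w'.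
- have [u' [v' [lu lv u'v']]] := linked_cross uV vV d.
  exact: (splice_many_cross (c := true) HA HB lu lv).
- have [v' [u' [lv lu v'u']]] := linked_cross vV uV d.
  have [L [uL sL HL]] := splice_many_cross (c := false) HB HA
    (linked_sym lu) (linked_sym lv) v'u'.
  by exists L; rewrite mulnC; split=> // p /HL; apply: eq_hampath.
(* Both ends start with E: the halves change roles, and [linked_low] locates the detour. *)
- have [||L [uL sL HL]] := HBA u v; first by split=> //; left.
    move=> p hp; have [s' [w [w' [t [-> [z [z' [zw zw' l]]]]]]]] := linked_low d hp.
    by exists s', w, w', t; split=> //; exists z, z'.
  by exists L; rewrite mulnC; split=> // p /HL; apply: eq_hampath.
Qed.

End Step.

(** This is the bound [n <= h(Q)], with a single vertex treated as in [linked]. *)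
Definition good n Q := many_hampaths n (dom 0 ^~ Q).

Lemma good_cons_false n Q : good n Q -> good n (false :: Q).
Proof.
move=> H [|a u] [|b v] [] //= /andP[a0 Du] /andP[b0 Dv] d.
case: a b a0 b0 Du Dv d => [] [] //= _ _ Du Dv d.
have [|L [uL sL HL]] := H u v.
  split=> //; case: d => [|[[->] S]]; first by left.
  by right; split=> // w Dw; have [] := S (false :: w) Dw.
exists (map (map (cons false)) L); split.
- by rewrite map_inj_uniq //; apply/inj_map/cons_inj.
- by rewrite size_map.
move=> _ /mapP[p /HL + ->]; case: p => [[]//|_ p [[->] lp sp up' mp]]; split=> //.
- by rewrite /= last_map -lp.
- by rewrite sorted_adj_map.
- by rewrite map_inj_uniq //; apply: cons_inj.
by case=> [|[] w]; rewrite ?nil_map_cons ?mem_map_cons //= mp.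
Qed.

Lemma good_nseq b : good 1 (nseq b true).
Proof.
have S w : dom 0 w (nseq b true) -> w = nseq b true.
  move=> D; apply: dom_single D; last exact: dom_refl.
  by elim: (b) => //= n ->.
move=> u v [uV vV _]; exists [:: [:: u]]; split=> // p; rewrite inE => /eqP->.
split=> //=; first by rewrite (S _ uV) (S _ vV).
move=> w; rewrite inE -[RHS]/(dom 0 w (nseq b true)).
by apply/eqP/idP => [->//|/S->]; rewrite (S _ uV).
Qed.

Lemma good_step m n b Q :
  good m (nseq b true ++ false :: Q) -> good n (nseq b.+1 true ++ Q) ->
  good (m * n) (nseq b.+1 true ++ false :: Q).
Proof.
move=> H1; have -> : nseq b.+1 true ++ Q = nseq b true ++ true :: Q.
  by elim: (b) => //= n' ->.
move=> H2; set T := nseq b true ++ false :: Q.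
have e w : dom 1 w T = dom 0 w (nseq b true ++ true :: Q) by rewrite /T dom_shift.
apply: (@eq_many_hampaths _ (splice (dom 0 ^~ T) (dom 1 ^~ T) true)).
  by case=> [|[] w].
apply: (@many_hampaths_step 0 T _ _ (nseq b true ++ true :: Q)) => //.
  by rewrite e dom_refl.
by apply: eq_many_hampaths H2 => w; rewrite e.
Qed.

(** * Corners and superfactorials *)

Lemma nseqSr_cat (T : Type) b (x : T) s : nseq b.+1 x ++ s = nseq b x ++ x :: s.
Proof. by elim: b => //= b ->. Qed.

(** The cases mirror [good_step]; both paths to which it refers are one letter shorter. *)
Lemma corner_ind (P : word -> Prop) :
  (forall b, P (nseq b true)) -> (forall Q, P Q -> P (false :: Q)) ->
  (forall b Q, P (nseq b true ++ false :: Q) -> P (nseq b.+1 true ++ Q) ->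
     P (nseq b.+1 true ++ false :: Q)) ->
  forall Q, P Q.
Proof.
move=> P1 P2 P3 Q; elim: {Q}(size Q).+1 {-2}Q (ltnSn (size Q)) => // n IH Q lt.
have [[b e]|[b [Q' e]]] : (exists b, Q = nseq b true) \/
    (exists b Q', Q = nseq b true ++ false :: Q').
  elim: (Q) => [|[] Q' IH']; first by left; exists 0.
    case: IH' => [[b ->]|[b [Q'' ->]]]; first by left; exists b.+1.
    by right; exists b.+1, Q''.
  by right; exists 0, Q'.
  by rewrite e.
rewrite e in lt *; case: b lt {e} => [|b] lt; first exact: P2 (IH _ lt).
move: lt; rewrite !size_cat !size_nseq /= => lt.
by apply: P3; apply: IH; rewrite size_cat size_nseq /=; lia.
Qed.

(* [p] tells whether the step before [Q] is an N. *)
Fixpoint corners_after (p : bool) (Q : word) : nat :=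
  if Q is c :: Q' then (p && ~~ c) + corners_after c Q' else 0.

Definition corners := corners_after false.

Definition lead (Q : word) := index false Q.

Lemma corners_after_nseq p b Q :
  corners_after p (nseq b true ++ Q) = corners_after (p || (0 < b)) Q.
Proof.
by elim: b p => [|b IH] p /=; rewrite ?orbF // IH andbF orbT add0n; case: b IH.
Qed.

Lemma corners_nseq_cons b Q :
  corners (nseq b true ++ false :: Q) = (0 < b) + corners Q.
Proof. by rewrite /corners corners_after_nseq /= andbT. Qed.

Lemma corners_nseq b : corners (nseq b true) = 0.
Proof. by rewrite -[nseq b true]cats0 /corners corners_after_nseq. Qed.

Lemma lead_nseq b Q : lead (nseq b true ++ Q) = b + lead Q.
Proof. by rewrite /lead; elim: b => //= b ->. Qed.

Lemma lead_nseq_cons b Q : lead (nseq b true ++ false :: Q) = b.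
Proof. by rewrite lead_nseq /lead /= addn0. Qed.

Lemma good1 Q : good 1 Q.
Proof.
elim/corner_ind: Q => [b|Q|b Q H1 H2]; first exact: good_nseq.
- exact: good_cons_false.
- by rewrite -(mul1n 1); apply: good_step.
Qed.

Lemma goodW m n Q : m <= n -> good n Q -> good m Q.
Proof. exact: many_hampathsW. Qed.

Lemma corners_gt0_false Q : 0 < corners Q -> false \in Q.
Proof.
suff H p : 0 < corners_after p Q -> false \in Q by apply: H.
elim: Q p => //= -[] Q IH p; last by rewrite inE.
by rewrite andbF add0n inE => /IH.
Qed.

(** Listing the words by the position of their only E makes their number [b.+1] evident. *)
Fixpoint one_corner (b c : nat) : seq word :=
  if b is b'.+1 then
    (false :: nseq (b + c) true) :: map (cons true) (one_corner b' c)
  else [:: false :: nseq c true].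

Lemma one_cornerP b c w :
  (w \in one_corner b c) = dom 0 w (nseq b true ++ false :: nseq c true).
Proof.
have S d x : dom 0 x (nseq d true) = (x == nseq d true).
  apply/idP/eqP => [|->]; last exact: dom_refl.
  move=> D; apply: dom_single D; last exact: dom_refl.
  by elim: (d) => //= n ->.
elim: b w => [|b IH] w /=; rewrite inE.
  by case: w => [|[] w] //=; rewrite S eqseq_cons.
case: w => [|[] w]; rewrite ?nil_map_cons ?mem_map_cons //=.
by rewrite eqseq_cons orbF -[0 + 1 - 0]/1 dom_shift -nseqSr_cat -nseqD S addSn.
Qed.

Lemma one_corner_uniq b c : uniq (one_corner b c).
Proof.
elim: b => //= b IH; rewrite mem_map_cons /= map_inj_uniq //; exact: cons_inj.
Qed.

Lemma size_one_corner b c : size (one_corner b c) = b.+1.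
Proof. by elim: b => //= b; rewrite size_map => ->. Qed.

(* These words are pairwise adjacent: each has a single E. *)
Lemma good_one_corner b c :
  good b.-1`! (nseq b true ++ false :: nseq c true).
Proof.
case: b => [|b]; first exact: good1.
set Q := _ ++ _; set l := one_corner b.+1 c.
have adjQ x y : dom 0 x Q -> dom 0 y Q -> x != y -> adj x y.
  have cQ x' : dom 0 x' Q -> up x' (nseq (size Q) true).
    move=> D; have c1 : count_mem false x' = 1.
      rewrite (dom_count_false D (dom_refl Q)) /Q count_cat /= !count_nseq /=.
      by rewrite !mul0n.
    have [z uz] : exists z, up x' z by apply: up_ex; rewrite c1.
    have c0 : count_mem false z = 0 by move: c1; rewrite (up_count uz) => -[].
    have := count_false_eq0 c0; rewrite (dom_size (dom_up D uz)) => <-.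
    exact: uz.
  by move=> /cQ Dx /cQ Dy; apply: up_adj_below Dx Dy.
move=> u v [uQ vQ d].
have neq : u != v.
  case: d => [a|[_ S]]; first by apply: contraTneq a => ->; rewrite adjxx.
  have := S (true :: nseq b true ++ false :: nseq c true) (dom_refl _).
  have <- : false :: nseq (b.+1 + c) true = u; last by [].
  by apply: S; rewrite -[dom _ _ _]one_cornerP mem_head.
have ul : u \in l by rewrite one_cornerP.
have vl : v \in rem u l.
  have vl : v \in l by rewrite one_cornerP.
  rewrite mem_rem_uniq ?one_corner_uniq //.
  by apply/andP; split; rewrite //= eq_sym.
set r := rem v (rem u l).
have pl : perm_eq l (u :: v :: r).
  by rewrite (permPl (perm_to_rem ul)) perm_cons perm_to_rem.
have sr : size r = b by rewrite !size_rem // size_one_corner.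
have ur : uniq (u :: v :: r) by rewrite -(perm_uniq pl) one_corner_uniq.
(* In a complete graph the remaining [b] vertices may be visited in any order. *)
exists [seq u :: rcons s v | s <- permutations r]; split.
- by rewrite map_inj_uniq ?permutations_uniq // => s s' [/rcons_inj[]].
- rewrite size_map size_permutations ?sr //.
  by case/and3P: ur.
move=> _ /mapP[s + ->]; rewrite mem_permutations => ps.
have ps' : perm_eq (u :: rcons s v) l.
  by rewrite perm_sym (permPl pl) perm_cons perm_sym perm_rcons perm_cons.
have us : uniq (u :: rcons s v) by rewrite (perm_uniq ps') one_corner_uniq.
have mem w : w \in u :: rcons s v -> dom 0 w Q.
  by rewrite (perm_mem ps') one_cornerP.
split=> //; first by rewrite /= last_rcons.
  have : sorted (fun x y => x != y) (u :: rcons s v).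
    by apply: pairwise_sorted; rewrite -uniq_pairwise.
  by apply: (sub_in_sorted _ (allss _)) => x y /mem Dx /mem Dy; apply: adjQ.
by move=> w; rewrite (perm_mem ps') one_cornerP.
Qed.

(** Bounding the N half by 1, one passes to the E half, which has one E less and at least as many
    leading N's, until a single E is left and the graph is complete. *)
Lemma good_fact Q : false \in Q -> good (lead Q).-1`! Q.
Proof.
elim/corner_ind: Q => [b|Q _ _|b Q _ H2 _].
- by rewrite mem_nseq andbF.
- exact: good1.
rewrite lead_nseq_cons /=; have [fQ|fQ] := boolP (false \in Q); last first.
  have -> : Q = nseq (size Q) true.
    by apply: count_false_eq0; apply/eqP; rewrite -leqn0 leqNgt -has_count has_pred1.
  exact: (@good_one_corner b.+1 _).
rewrite -(mul1n b`!); apply: good_step; first exact: good1.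
apply: goodW (H2 _); last by rewrite mem_cat fQ orbT.
by rewrite lead_nseq leq_fact //= leq_addr.
Qed.

Lemma sf0 : sf 0 = 1.
Proof. by rewrite /sf big_ord_recr big_ord0. Qed.

Lemma sfS x : sf x.+1 = sf x * (x.+1)`!.
Proof. by rewrite /sf big_ord_recr. Qed.

Lemma sf_gt0 x : 0 < sf x.
Proof. by rewrite /sf prodn_gt0 // => i; apply: fact_gt0. Qed.

Lemma leq_sf x y : x <= y -> sf x <= sf y.
Proof.
move=> /subnK<-; elim: (y - x) => // n; rewrite addSn sfS => IH.
by apply: leq_trans IH _; rewrite leq_pmulr // fact_gt0.
Qed.

(** If an E follows the first corner, the E half keeps the lead and the corners. If an N follows,
    the E half loses a corner but gains a leading N, which balances [lead Q + i]; the N half is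
    counted as 1 except when [i] is 0. *)
Lemma good_sf i Q : i.+1 < corners Q -> good (sf (lead Q + i)) Q.
Proof.
elim/corner_ind: Q i => [b|Q IH|b Q IH1 IH2] i.
- by rewrite corners_nseq.
- move=> /IH /good_cons_false; apply: goodW; apply: leq_sf.
  by rewrite leq_add2r.
rewrite corners_nseq_cons /= add1n ltnS lead_nseq_cons => cQ.
case: Q IH1 IH2 cQ => // -[] Q IH1 IH2 cQ; last first.
  rewrite -(mul1n (sf _)); apply: good_step; first exact: good1.
  by have := IH2 i; rewrite corners_nseq_cons add1n ltnS lead_nseq_cons; apply.
have c2 : corners (nseq b.+1 true ++ true :: Q) = corners (true :: Q).
  by rewrite -nseqSr_cat /corners corners_after_nseq.
have l2 : b.+2 <= lead (nseq b.+1 true ++ true :: Q).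
  by rewrite lead_nseq /lead /= addnS ltnS leq_addr.
case: i cQ => [|i] cQ; last first.
  rewrite -(mul1n (sf _)); apply: good_step; first exact: good1.
  apply: goodW (IH2 i _); last by rewrite c2.
  by apply: leq_sf; lia.
(* For [i = 0] both factors count: the N half has one leading N less and yields [sf b], while the E
   half has at least [b.+2] leading N's and yields [(b.+1)!]. *)
rewrite addn0 sfS; apply: good_step; last first.
  apply: goodW (good_fact _); last by rewrite mem_cat (corners_gt0_false cQ) orbT.
  by rewrite leq_fact // -ltnS prednK // (leq_ltn_trans _ l2).
case: b IH1 {IH2 c2 l2} => [|b] IH1; first by rewrite sf0; exact: good1.
by have := IH1 0; rewrite corners_nseq_cons add1n ltnS lead_nseq_cons addn0; apply.
Qed.

Lemma good_catalan k Q : k.+2 <= corners Q -> good (sf k.+1 * sf k) Q.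
Proof.
elim/corner_ind: Q k => [b|Q IH|b Q IH1 IH2] k.
- by rewrite corners_nseq.
- by move=> /IH /good_cons_false.
rewrite corners_nseq_cons /= add1n ltnS => cQ.
case: b IH1 IH2 => [|b] IH1 IH2; last first.
  rewrite -(muln1 (_ * _)); apply: (@good_step _ _ b.+1); last exact: good1.
  by apply: IH1; rewrite corners_nseq_cons add1n ltnS.
case: Q IH1 IH2 cQ => // -[] Q IH1 IH2 cQ; last first.
  rewrite -(mul1n (_ * _)); apply: (@good_step _ _ 0); first exact: good1.
  by apply: IH2; rewrite corners_nseq_cons add1n ltnS.
case: k cQ => [|k] cQ; first by rewrite sfS sf0; exact: good1.
apply: (@goodW _ ((sf k.+1 * sf k) * sf k.+2)).
  by rewrite mulnC leq_mul2r -{1}[sf k.+1]muln1 leq_mul2l sf_gt0 !orbT.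
apply: (@good_step _ _ 0); first by apply: IH1; rewrite /corners /= add0n in cQ *.
have c2 : corners [:: true, true & Q] = corners (true :: Q) by [].
apply: goodW (good_sf (i := k) _); last by rewrite c2.
by apply: leq_sf; rewrite /lead /=; lia.
Qed.

(** * A Catalan minor forces corners *)

Section ExchangePattern.
Variables I J : finType.

Definition exchange_pattern (T : finType) (M : matroid T) (R : I -> J -> bool) :=
  exists B a c, [/\ B \in bases M, forall i, a i \in B,
    forall j, c j \in ground M :\: B &
    forall i j, (c j |: (B :\ a i) \in bases M) = R i j].

End ExchangePattern.

Lemma mem_dual_bases (T : finType) (M : matroid T) (X : {set T}) :
  X \subset ground M -> (ground M :\: X \in bases (dual M)) = (X \in bases M).
Proof.
have DD (A : {set T}) : A \subset ground M -> ground M :\: (ground M :\: A) = A.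
  by move=> AM; rewrite setDDr setDv set0U; apply/setIidPr.
move=> XG; apply/imsetP/idP => [[A AM e]|]; last by exists X.
by rewrite -(DD X XG) e DD ?bases_ground.
Qed.

(** Under complementation, exchanging [a i] for [c j] becomes exchanging [c j] for [a i], which
    transposes the pattern. *)
Lemma exchange_pattern_dual (I J T : finType) (M : matroid T) (R : I -> J -> bool) :
  exchange_pattern (dual M) R -> exchange_pattern M (fun j i => R i j).
Proof.
case=> _ [a [c [/imsetP[B BM ->] aB cB ex]]]; exists B, c, a.
have cB' j : c j \in B.
  by have := cB j; rewrite !inE negb_and negbK => /andP[/orP[//|/negPf->]].
split=> // j i; rewrite -ex -mem_dual_bases; last first.
  have := bases_ground BM; have := aB i; rewrite inE => /andP[_ aG] sB.
  by rewrite subUset sub1set aG (subset_trans (subD1set _ _) sB).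
suff -> : ground M :\: (a i |: (B :\ c j)) = c j |: ((ground M :\: B) :\ a i) by [].
apply/setP=> x; rewrite !inE negb_or negb_and negbK.
case: (eqVneq x (c j)) => [->|_] /=; last by rewrite andbA.
rewrite andbT; have := aB i; have := cB j; rewrite !inE => /andP[_ ->] /andP[aB' _].
by rewrite andbT; apply: contraNneq aB' => <-.
Qed.

(** A basis of the deletion is the trace of a basis [B] of [M] with maximal trace, and this [B]
    carries the pattern. *)
Lemma exchange_pattern_deletion (I J T : finType) (M : matroid T) (Y : {set T})
    (R : I -> J -> bool) :
  exchange_pattern (deletion M Y) R -> exchange_pattern M R.
Proof.
case=> _ [a [c [/deletion_basesP[B [BM -> maxB]] aB cB ex]]]; exists B, a, c.
set F := ground M :\: Y in maxB aB cB ex.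
have aB' i : a i \in B by have := aB i; rewrite inE => /andP[].
have aF i : a i \in F by have := aB i; rewrite inE => /andP[].
have cF j : c j \in F by have := cB j; rewrite inE => /andP[].
have cB' j : c j \notin B by have := cB j; rewrite in_setD in_setI cF !andbT.
have cG j : c j \in ground M by have := cF j; rewrite inE => /andP[].
split=> // [j|i j]; first by rewrite inE cB' cG.
have capE : (c j |: (B :\ a i)) :&: F = c j |: (B :&: F :\ a i).
  apply/setP=> x; rewrite !in_setI !in_setU1 !in_setD1 in_setI.
  by case: (eqVneq x (c j)) => [->|_] /=; rewrite ?cF // andbA.
have cardE : #|c j |: (B :&: F :\ a i)| = #|B :&: F|.
  rewrite cardsU1 !inE (negPf (cB' j)) andbF /= [in RHS](cardsD1 (a i)).
  by rewrite in_setI aB' aF.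
rewrite -ex; apply/idP/idP => [B'M|/deletion_basesP[C [CM eC maxC]]].
  apply/deletion_basesP; exists (c j |: (B :\ a i)); split=> // C CM.
  by rewrite -/F capE cardE maxB.
rewrite -/F in eC maxC.
have cC : c j \in C.
  by have /setIP[] : c j \in C :&: F by rewrite -eC setU11.
(* Inserting [c j] into [B] expels some [y] outside [C]. If [y] is not [a i], it lies in the deleted
   part, and the trace would exceed its maximal size. *)
have [|y] := bases_coexchange (x := c j) BM CM; first by rewrite inE cB'.
rewrite inE => /andP[yC yB] B'M; have [<-//|ya] := eqVneq y (a i).
have yF : y \notin F.
  apply: contraNN yC => yF; have /setIP[] // : y \in C :&: F.
  by rewrite -eC !inE ya yB -in_setD yF orbT.
have := maxB _ B'M; rewrite leqNgt -/F => /negP[]; apply: proper_card.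
apply/properP; split; last first.
  by exists (c j); rewrite in_setI ?setU11 ?cF // (negPf (cB' j)).
apply/subsetP=> x; rewrite !in_setI !in_setU1 in_setD1 => /andP[-> xF].
by rewrite xF andbT; apply/orP; right; rewrite andbT; apply: contraNneq yF => <-.
Qed.

Lemma exchange_pattern_iso (I J T T' : finType) (M : matroid T) (M' : matroid T')
    (R : I -> J -> bool) :
  matroid_iso M M' -> exchange_pattern M' R -> exchange_pattern M R.
Proof.
case=> f [injf fG fB] [B' [a' [c' [B'M aB cB ex]]]].
have pre x' : x' \in ground M' -> exists2 x, x \in ground M & x' = f x.
  by rewrite -fG => /imsetP[x xG ->]; exists x.
have aG i : a' i \in ground M' by apply: (subsetP (bases_ground B'M)).
have cG j : c' j \in ground M' by have := cB j; rewrite inE => /andP[].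
have [a aE] : exists a, forall i, a i \in ground M /\ a' i = f (a i).
  apply: (@fin_all_exists _ (fun=> T) (fun i x => x \in ground M /\ a' i = f x)) => i.
  by have [x] := pre _ (aG i); exists x.
have [c cE] : exists c, forall j, c j \in ground M /\ c' j = f (c j).
  apply: (@fin_all_exists _ (fun=> T) (fun j x => x \in ground M /\ c' j = f x)) => j.
  by have [x] := pre _ (cG j); exists x.
pose B := [set x in ground M | f x \in B'].
have sB : B \subset ground M by apply/subsetP=> x; rewrite inE => /andP[].
have fBE : f @: B = B'.
  apply/setP=> x'; apply/imsetP/idP => [[x + ->]|x'B].
    by rewrite inE => /andP[].
  have [x xG e] := pre _ (subsetP (bases_ground B'M) _ x'B).
  by exists x => //; rewrite inE xG -e.
exists B, a, c; split.
- by rewrite fB // fBE.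
- by move=> i; have [aG' e] := aE i; rewrite inE aG' -e aB.
- move=> j; have [cG' e] := cE j; rewrite !inE cG' -e /= andbT.
  by have := cB j; rewrite inE => /andP[].
move=> i j; have [aG' ea] := aE i; have [cG' ec] := cE j.
rewrite fB; last first.
  by rewrite subUset sub1set cG' (subset_trans (subD1set _ _) sB).
rewrite -ex ea ec imsetU1 -fBE; suff -> : f @: (B :\ a i) = (f @: B) :\ f (a i) by [].
apply/setP=> x'; apply/imsetP/setD1P => [[x /setD1P[xa xB] ->]|[x'a /imsetP[x xB ex']]].
  split; last exact: imset_f.
  by apply: contraNneq xa => /(injf _ _ (subsetP sB _ xB) aG')->.
exists x => //; apply/setD1P; split=> //.
by apply: contraNneq x'a => <-; rewrite ex'.
Qed.

(** Contraction is deletion in the dual, so the pattern is transposed twice. *)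
Lemma exchange_pattern_minor (I J T T' : finType) (M : matroid T) (N : matroid T')
    (R : I -> J -> bool) :
  has_minor M N -> exchange_pattern N R -> exchange_pattern M R.
Proof.
case=> X [Y [_ _ _ iso]] /(exchange_pattern_iso iso) /exchange_pattern_deletion.
by move/exchange_pattern_dual/exchange_pattern_deletion/exchange_pattern_dual.
Qed.

(** * Heights, touch points and corners *)

Definition ht (w : word) (t : nat) : nat := count_mem true (take t w).

Definition word_of (n : nat) (B : {set 'I_n}) : word := [seq j \in B | j <- enum 'I_n].

Lemma size_word_of n (B : {set 'I_n}) : size (word_of B) = n.
Proof. by rewrite size_map size_enum_ord. Qed.

Lemma nth_word_of n (B : {set 'I_n}) (j : 'I_n) : nth false (word_of B) j = (j \in B).
Proof. by rewrite (nth_map j) ?size_enum_ord // nth_ord_enum. Qed.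

Lemma ht_word_of n (B : {set 'I_n}) t : t <= n ->
  ht (word_of B) t = #|[set j in B | j < t]|.
Proof.
move=> le_t; rewrite /ht /word_of -map_take count_map.
have -> : take t (enum 'I_n) = [seq j : 'I_n <- enum 'I_n | j < t].
  apply: (inj_map val_inj); rewrite map_take -(filter_map val (fun j => j < t)).
  rewrite val_enum_ord take_iota (minn_idPl le_t).
  exact/esym/(filter_iota_ltn 0 le_t).
rewrite cardE -size_filter -filter_predI enumT; congr size.
by apply: eq_filter => j /=; rewrite !inE eqb_id.
Qed.

Lemma htS w t : t < size w -> ht w t.+1 = ht w t + nth false w t.
Proof.
by move=> lt; rewrite /ht (take_nth false lt) -cats1 count_cat /= eqb_id addn0.
Qed.

Lemma ht_le w s t : s <= t -> ht w s <= ht w t <= ht w s + (t - s).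
Proof.
move=> le; rewrite /ht -(subnKC le) takeD count_cat leq_addr leq_add2l addKn.
by rewrite (leq_trans (count_size _ _)) // size_take_min geq_minl.
Qed.

Lemma corners_after_cat p x y :
  corners_after p (x ++ y) = corners_after p x + corners_after (last p x) y.
Proof. by elim: x p => //= c x IH p; rewrite IH addnA. Qed.

Lemma corners_after_gt0 p x y :
  true \in x -> false \in y -> 0 < corners_after p (x ++ y).
Proof.
have key z : false \in z -> 0 < corners_after true z.
  by elim: z => //= -[] z IH //; rewrite inE.
elim: x p => //= -[] x IH p; rewrite inE /=.
  by move=> _ fy; rewrite addn_gt0 key ?orbT // mem_cat fy orbT.
by move=> tx fy; rewrite addn_gt0 IH ?orbT.
Qed.

(* Between two touch points [s] and [e], a segment without a corner has the form
   E^p N^q; the path [w] below it then coincides with it. *)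
Lemma corners_segment (w Q : word) s e a c :
  size w = size Q -> (forall t, t <= size Q -> ht w t <= ht Q t) ->
  ht w s = ht Q s -> ht w e = ht Q e -> e <= size Q ->
  s <= a -> a < e -> s <= c -> c < e ->
  nth false w a -> ~~ nth false w c ->
  (forall t, c < t <= a -> ht w t < ht Q t) ->
  corners (take s Q) < corners (take e Q).
Proof.
move=> sz le hs he le_e sa ae sc ce wa wc gap.
(* At [i], the path [Q] has made an N since [s] and still has an E to make before [e], so a corner
   lies between. *)
have [i [si ie lo hi]] : exists i, [/\ s <= i, i <= e, ht Q s < ht Q i
    & ht Q e < ht Q i + (e - i)].
  have [ac|ca|eq] := ltngtP a c; last by rewrite -eq wa in wc.
    exists a.+1; have := htS (_ : a < size w); rewrite wa => /(_ _)/= ha.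
    have := htS (_ : c < size w); rewrite (negPf wc) => /(_ _)/= hc.
    have := ht_le w sa; have := ht_le w ac; have := ht_le w ce.
    have := le a.+1.
    by move=> ? ? ? ?; split; lia.
  exists c.+1; have := ht_le w ce; have := ht_le w (leqW sc); have := gap c.+1.
  by move=> ? ? ?; split; lia.
have -> : take e Q = take s Q ++ (take (i - s) (drop s Q) ++ take (e - i) (drop i Q)).
  by rewrite catA -takeD subnKC // -takeD subnKC.
rewrite /corners [in ltnRHS]corners_after_cat -[ltnLHS]addn0 ltn_add2l.
have cnt x y : x <= y -> ht Q y = ht Q x + count_mem true (take (y - x) (drop x Q)).
  by move=> xy; rewrite /ht -{1}(subnKC xy) takeD count_cat.
apply: corners_after_gt0.
  by rewrite -has_pred1 has_count; have := cnt _ _ si; lia.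
rewrite -has_pred1 has_count.
have := count_false_true (take (e - i) (drop i Q)).
by rewrite size_takel ?size_drop; have := cnt _ _ ie; lia.
Qed.

Section GcatExchange.
Variables (m r : nat) (Q : lattice_path m r) (B : {set 'I_(m + r)}).
Hypothesis BQ : B \in gcat_bases Q.

(** The exchange raises the path by one exactly at the [t] with [c < t <= a], and nowhere else can
    it break the bound. *)
Lemma gcat_exchangeE a c : a \in B -> c \notin B ->
  (c |: (B :\ a) \in gcat_bases Q) =
  [forall t : 'I_(m + r).+1, (c < t <= a) ==> (#|[set j in B | j < t]| < height Q t)].
Proof.
move=> aB cB; have [cardB leB] := gcat_basesP _ _ BQ.
have cE t : #|[set j in c |: (B :\ a) | j < t]| + (a < t) =
            #|[set j in B | j < t]| + (c < t).
  set S1 := (X in #|pred_of_set X| + _ = _); set S2 := (X in _ = #|pred_of_set X| + _).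
  have e : S1 :\ c = S2 :\ a.
    apply/setP=> x; rewrite !inE; case: (eqVneq x c) => [->|_] //=.
      by rewrite (negPf cB) andbF.
    by rewrite andbA.
  by rewrite (cardsD1 c S1) (cardsD1 a S2) e !inE eqxx aB /=; lia.
have cardE : #|c |: (B :\ a)| = r.
  apply: etrans cardB.
  by rewrite cardsU1 !inE (negPf cB) andbF [RHS](cardsD1 a B) aB.
apply/gcat_basesP/forallP => [[_ le] t|H].
  apply/implyP=> /andP[ct ta]; have := le t (ltn_ord t); have := cE t.
  by rewrite ct ltnNge ta addn0 addn1 => ->.
split=> // t le_t; have := cE t; have := leB t le_t.
have [at_|ta] := ltnP a t; first by case: (c < t); lia.
have := H (Ordinal (le_t : t < (m + r).+1)); rewrite /= ta andbT.
by case: (c < t) => /=; lia.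
Qed.

End GcatExchange.

(** The failing exchange of the element [i.+1] of [a] for [c i] gives a touch point after [c i] and
    no later than that element. With the start and the end of the path, these points bound [k]
    segments, each containing a corner. *)
Lemma corners_of_pattern m r (Q : lattice_path m r) k :
  exchange_pattern (gcat_matroid Q) (fun i j : 'I_k => i <= j) ->
  k <= corners (val Q).
Proof.
case=> B [a [c [BQ aB cB ex]]]; have [cardB leB] := gcat_basesP _ _ BQ.
have cB' j : c j \notin B by have := cB j; rewrite inE => /andP[].
set q : word := val (val Q); pose w := word_of B.
have szq : size q = m + r by rewrite size_tuple.
have szw : size w = size q by rewrite size_word_of szq.
have gE t : t <= m + r -> ht w t = #|[set j in B | j < t]| by apply: ht_word_of.
have le_wq t : t <= size q -> ht w t <= ht q t.
  by rewrite szq => le_t; rewrite gE // leB.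
have gap (i j : 'I_k) : (i <= j) = [forall t : 'I_(m + r).+1,
    (c j < t <= a i) ==> (ht w t < ht q t)].
  rewrite -ex [LHS](gcat_exchangeE BQ (aB i) (cB' j)).
  by apply: eq_forallb => t; rewrite gE // -ltnS.
have gap_ii (i : 'I_k) t : c i < t <= a i -> ht w t < ht q t.
  move=> tP; have lt : t < (m + r).+1 by have := ltn_ord (a i); lia.
  have /forallP/(_ (Ordinal lt))/implyP H := etrans (esym (gap i i)) (leqnn i).
  exact: H.
(* The successful exchange of [a i] for [c i] excludes touch points [t] with [c i < t <= a i], so
   both steps fall between [s] and [e]. *)
have seg (i : 'I_k) s e : i <= corners (take s q) -> ht w s = ht q s ->
    s <= a i -> ht w e = ht q e -> e <= size q -> c i < e -> i < corners (take e q).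
  move=> ci hs sa he le_e ce; apply: leq_ltn_trans ci _.
  have sc : s <= c i.
    by rewrite leqNgt; apply/negP=> cs; have := gap_ii i s; rewrite cs sa hs ltnn => /(_ isT).
  have ae : a i < e.
    by rewrite ltnNge; apply/negP=> ea; have := gap_ii i e; rewrite ce ea he ltnn => /(_ isT).
  apply: (corners_segment szw le_wq hs he le_e sa ae sc ce _ _ (gap_ii i)).
    by rewrite nth_word_of.
  by rewrite nth_word_of.
have full : ht w (m + r) = ht q (m + r).
  rewrite gE // (_ : [set j in B | _] = B); last first.
    by apply/setP=> j; rewrite inE ltn_ord andbT.
  rewrite cardB /ht take_oversize ?szq //; exact/esym/eqP/(valP Q).
have main i (lt : i < k) : exists s, [/\ i <= corners (take s q), ht w s = ht q s
    & s <= a (Ordinal lt)].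
  elim: i lt => [|i IH] lt; first by exists 0; rewrite /ht !take0.
  have [s [ci hs sa]] := IH (ltnW lt).
  have := gap (Ordinal lt) (Ordinal (ltnW lt)); rewrite /= ltnn => /esym/negbT/forallPn[t].
  rewrite negb_imply -leqNgt => /andP[/andP[ct ta] le_t].
  have lt_t : t <= size q by rewrite szq -ltnS.
  have ht_t : ht w t = ht q t by apply/eqP; rewrite eqn_leq le_wq.
  exists t; split=> //; exact: (seg (Ordinal (ltnW lt)) s).
case: k a c aB cB ex cB' gap gap_ii seg main => // k a c aB cB ex cB' gap gap_ii seg main.
have [s [ci hs sa]] := main k (ltnSn k).
have := seg (Ordinal (ltnSn k)) s (m + r) ci hs sa full.
by rewrite take_oversize ?szq //; apply.
Qed.

(** The basis is the path itself, which touches everywhere. With [a i] at position [2i] and [c j] at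
    [2j+1], an exchange is legal only if no [t] satisfies [2j+1 < t <= 2i]. *)
Lemma kcat_pattern k :
  exchange_pattern (kcat_matroid k) (fun i j : 'I_k => i <= j).
Proof.
have lta (i : 'I_k) : i.*2 < k + k by have := ltn_ord i; rewrite -muln2; lia.
have ltc (i : 'I_k) : i.*2.+1 < k + k by have := ltn_ord i; rewrite -muln2; lia.
have nthk i : i < k + k -> nth stepN (kcat_word k) i = ~~ odd i.
  elim: (k) i => [|k' IH] [|[|i]] //=; rewrite addSn addnS !ltnS => /IH ->.
  by rewrite negbK.
have tnthk (j : 'I_(k + k)) : (j \in Nsteps (kcat_path k)) = ~~ odd j.
  by rewrite inE (tnth_nth stepN) nthk // eqb_id.
have BQ : Nsteps (kcat_path k) \in gcat_bases (kcat_path k).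
  by apply: imset_f; rewrite inE; apply/forallP.
exists (Nsteps (kcat_path k)), (fun i => Ordinal (lta i)), (fun j => Ordinal (ltc j)).
have aB i : Ordinal (lta i) \in Nsteps (kcat_path k) by rewrite tnthk /= odd_double.
have cB j : Ordinal (ltc j) \notin Nsteps (kcat_path k).
  by rewrite tnthk /= odd_double.
split=> // [j|i j]; first by rewrite inE cB inE.
rewrite [LHS](gcat_exchangeE BQ (aB i) (cB j)); apply/forallP/idP => [H|le_ij t].
  rewrite leqNgt; apply/negP=> lt_ji; have lt := ltnW (lta i : i.*2 < (k + k)).
  have /implyP/= := H (Ordinal (lt : i.*2 < (k + k).+1)).
  rewrite -heightE // ltnn leqnn andbT => C.
  by suff: false by []; apply: C; rewrite -!muln2; lia.
by apply/implyP=> /= /andP[]; rewrite -!muln2; lia.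
Qed.

Lemma corners_of_minor m r (Q : lattice_path m r) k :
  has_minor (gcat_matroid Q) (kcat_matroid k) -> k <= corners (val Q).
Proof. by move=> mi; apply/corners_of_pattern/(exchange_pattern_minor mi)/kcat_pattern. Qed.

(** * From words to the basis graph *)

(** This supplies the three vertices that a Hamiltonian cycle needs. At each corner, the path itself
    joins the words starting with E. *)
Lemma many_words i Q : i <= corners Q ->
  exists s, [/\ uniq s, i < size s & forall w, w \in s -> dom 0 w Q].
Proof.
elim/corner_ind: Q i => [b|Q IH|b Q _ IH] i.
- rewrite corners_nseq leqn0 => /eqP->; exists [:: nseq b true]; split=> // w.
  by rewrite inE => /eqP->; apply: dom_refl.
- move=> /IH[s [us ss Ds]]; exists (map (cons false) s).
  rewrite map_inj_uniq ?size_map; last exact: cons_inj.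
  by split=> // _ /mapP[w /Ds Dw ->].
rewrite corners_nseq_cons /= => le_i.
have [|s [us ss Ds]] := IH i.-1.
  rewrite /corners corners_after_nseq /=.
  have le : corners Q <= corners_after true Q by case: (Q) => // c Q'; apply: leq_addl.
  by apply: (leq_trans _ le); lia.
exists ((nseq b.+1 true ++ false :: Q) :: map (cons false) s); split.
- by rewrite /= mem_map_cons map_inj_uniq //; apply: cons_inj.
- by rewrite /= size_map ltnS; case: (i) ss.
- move=> w; rewrite inE => /predU1P[->|/mapP[w' /Ds Dw' ->]]; first exact: dom_refl.
  by rewrite /= dom_shift -nseqSr_cat.
Qed.

Lemma dom_htP d w Q : reflect
  [/\ size w = size Q, ht w (size Q) = d + ht Q (size Q) &
      forall t, t <= size Q -> ht w t <= d + ht Q t] (dom d w Q).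
Proof.
apply: (iffP idP).
  move=> D; have sz := dom_size D; split=> //.
    by rewrite /ht take_size -sz take_size (dom_count D).
  elim: Q d w D {sz} => [|b Q IH] d [|a w] //= /andP[ab /IH{}IH] [|t] //=.
  rewrite ltnS /ht /= !eqb_id => /IH; rewrite /ht.
  by move: ab; case: (a); case: (b) => /=; lia.
elim: Q d w => [|b Q IH] d [|a w] [] //=.
  by move=> _; rewrite /ht /= addn0 => <-.
move=> [sz]; rewrite /ht /= !eqb_id => e le.
have ab : a <= d + b by have := le 1 isT; rewrite /= !take0 /= !eqb_id !addn0.
rewrite ab; apply: IH; split=> //.
  by rewrite /ht; move: ab e; case: (a); case: (b) => /=; lia.
move=> t lt; have := le t.+1 lt; rewrite /= !eqb_id /ht.
by move: ab; case: (a); case: (b) => /=; lia.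
Qed.

Definition hamming (x y : word) : nat := count (fun p => p.1 != p.2) (zip x y).

Lemma hamming_eq0 x y : size x = size y -> (hamming x y == 0) = (x == y).
Proof.
rewrite /hamming; elim: x y => [|a x IH] [|b y] //= [/IH{}IH].
by rewrite eqseq_cons addn_eq0 IH eqb0 negbK.
Qed.

Lemma up_hamming x y : size x = size y ->
  up x y = (count_mem true y == (count_mem true x).+1) && (hamming x y == 1).
Proof.
elim: x y => [|a x IH] [|b y] //= [sz]; rewrite {}IH // -(hamming_eq0 sz).
have le : count_mem true y <= count_mem true x + hamming x y.
  by elim: x y sz => [|c x IH] [|d y] //= [/IH]; rewrite /hamming /=;
     case: c; case: d => /=; lia.
have le' : count_mem true x <= count_mem true y + hamming x y.
  by elim: x y sz {le} => [|c x IH] [|d y] //= [/IH]; rewrite /hamming /=;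
     case: c; case: d => /=; lia.
move: le le'; rewrite /hamming /=; case: a; case: b => /=; lia.
Qed.

Lemma adj_hamming x y : size x = size y ->
  adj x y = (count_mem true x == count_mem true y) && (hamming x y == 2).
Proof.
elim: x y => [|a x IH] [|b y] //= [sz].
rewrite {}IH // !up_hamming // /hamming /=.
have -> : count (fun p => p.1 != p.2) (zip y x) = count (fun p => p.1 != p.2) (zip x y).
  elim: x y sz => [|c x IH] [|d y] //= [/IH->].
  by rewrite eq_sym.
by case: a; case: b => /=; lia.
Qed.

Lemma hamming_word_of n (B B' : {set 'I_n}) :
  #|(B :\: B') :|: (B' :\: B)| = hamming (word_of B) (word_of B').
Proof.
rewrite /hamming /word_of.
have -> : zip [seq j \in B | j <- enum 'I_n] [seq j \in B' | j <- enum 'I_n] =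
    [seq (j \in B, j \in B') | j <- enum 'I_n] by elim: (enum _) => //= j s ->.
rewrite count_map cardE -size_filter enumT; congr size.
apply: eq_filter => j /=; rewrite !inE.
by case: (j \in B); case: (j \in B').
Qed.

Lemma count_word_of n (B : {set 'I_n}) : count_mem true (word_of B) = #|B|.
Proof.
rewrite /word_of count_map cardE -size_filter enumT; congr size.
by apply: eq_filter => j /=; rewrite eqb_id.
Qed.

Lemma word_of_inj n : injective (@word_of n).
Proof. by move=> B B' e; apply/setP=> j; rewrite -!nth_word_of e. Qed.

Lemma word_of_set n (w : word) : size w = n ->
  word_of [set j : 'I_n | nth false w j] = w.
Proof.
move=> sz; apply: (@eq_from_nth _ false) => [|i]; rewrite size_word_of ?sz // => lt.
by rewrite (nth_word_of _ (Ordinal lt)) inE.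
Qed.

Lemma gcat_bases_dom m r (Q : lattice_path m r) (B : {set 'I_(m + r)}) :
  (B \in gcat_bases Q) = dom 0 (word_of B) (val (val Q)).
Proof.
have szQ : size (val (val Q)) = m + r by rewrite size_tuple.
have htB : ht (word_of B) (m + r) = #|B|.
  by rewrite /ht take_oversize ?size_word_of // count_word_of.
have htQ : ht (val (val Q)) (m + r) = r.
  by rewrite /ht take_oversize ?szQ //; apply/eqP/(valP Q).
apply/gcat_basesP/dom_htP => [[cB leB]|[_ + leB]]; rewrite szQ.
  rewrite size_word_of htB htQ add0n; split=> // t le_t.
  by rewrite ht_word_of //; apply: leB.
rewrite htB htQ add0n => cB; split=> // t le_t; rewrite -ht_word_of //.
by apply: leB; rewrite szQ.
Qed.

(** * Recovering a Hamiltonian path from the edge set of its cycle *)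

Section CycleEdges.
Variable V : finType.
Implicit Types (a b u v : V) (c s t : seq V).

Lemma cycle_edges_nbr c a b : uniq c -> [set a; b] \in cycle_edges c ->
  b = next c a \/ b = prev c a.
Proof.
move=> uc /imsetP[x xc e].
have : b \in [set x; next c x] by rewrite -e !inE eqxx orbT.
have : a \in [set x; next c x] by rewrite -e !inE eqxx.
have xe : x \in [set a; b] by rewrite e !inE eqxx.
have ne : next c x \in [set a; b] by rewrite e !inE eqxx orbT.
rewrite !inE => /orP[/eqP ea|/eqP ea] /orP[/eqP eb|/eqP eb]; subst.
- by left; move: ne; rewrite !inE orbb => /eqP.
- by left.
- by right; rewrite prev_next.
- by right; rewrite prev_next //; move: xe; rewrite !inE orbb => /eqP.
Qed.

Lemma next_neq_prev c a : uniq c -> 2 < size c -> a \in c -> next c a != prev c a.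
Proof.
move=> uc sc ac; apply/eqP=> e; have [i s er] := rot_to ac.
have E x : next c x = next (a :: s) x by rewrite -er next_rot.
have := next_prev uc a; rewrite -e !E {E e ac}.
have := uc; have := sc; rewrite -(size_rot i) -(rot_uniq i) er {er}.
case: s => [|b [|d s]] //= _; rewrite !inE !negb_or.
case/and3P=> /and3P[ab ad _] _ _; rewrite !eqxx [b == a]eq_sym (negPf ab) ?eqxx.
by move=> da; rewrite da eqxx in ad.
Qed.

Lemma cycle_traject u s : uniq (u :: s) ->
  u :: s = traject (next (u :: s)) u (size s).+1 /\ prev (u :: s) u = last u s.
Proof.
move=> us; have := cycle_next us; rewrite /= rcons_path => /andP[p /eqP l].
split; last by have := prev_next us (last u s); rewrite l.
by case/fpathP: p => n e; rewrite /= [in LHS]e; congr (_ :: traject _ _ _);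
   rewrite [in RHS]e size_traject.
Qed.

(** The common last vertex precedes [u] in both cycles and fixes the direction. From then on, the
    next vertex is the neighbour other than the previous one, and neighbours are determined by the
    edge set. *)
Lemma cycle_edges_inj u s t : uniq (u :: s) -> uniq (u :: t) -> 1 < size s ->
  size s = size t -> last u s = last u t ->
  cycle_edges (u :: s) = cycle_edges (u :: t) -> s = t.
Proof.
set c := u :: s; set d := u :: t => uc ud sc sz l e.
have [cE pc] := cycle_traject uc; have [dE pd] := cycle_traject ud.
have step a : a \in c -> prev c a = prev d a -> next c a = next d a.
  move=> ac pa; have := next_neq_prev uc (sc : 2 < size c) ac.
  have [|->//|->] := @cycle_edges_nbr d a (next c a) ud.
    by rewrite -/c -e; apply/imsetP; exists a.
  by rewrite pa eqxx.
have key i : [/\ iter i (next c) u \in c, iter i (next c) u = iter i (next d) u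
    & prev c (iter i (next c) u) = prev d (iter i (next c) u)].
  elim: i => [|i [ic ie ip]]; first by split; rewrite ?mem_head // pc pd.
  have en := step _ ic ip; split; rewrite ?iterS; first by rewrite mem_next.
    by rewrite -ie en.
  by rewrite prev_next // en prev_next.
have : c = d; last by case.
rewrite [LHS]cE [RHS]dE -sz; apply: (@eq_from_nth _ u); rewrite !size_traject //.
by move=> i lt; rewrite !nth_traject //; have [] := key i.
Qed.

End CycleEdges.

(** * From Hamiltonian paths of words to Hamiltonian cycles of bases *)

Section Transfer.
Variables (m r : nat) (Q : lattice_path m r).
Let V : finType := basis (gcat_matroid Q).
Let q : word := val (val Q).
Let wd (B : V) : word := word_of (val B).

Let wd_inj : injective wd.
Proof. by move=> B B' /word_of_inj/val_inj. Qed.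

Let dom_wd B : dom 0 (wd B) q.
Proof. by rewrite -gcat_bases_dom; apply: (valP B). Qed.

Let wd_ex w : dom 0 w q -> exists B, wd B = w.
Proof.
move=> D; have e : word_of [set j : 'I_(m + r) | nth false w j] = w.
  by apply: word_of_set; rewrite (dom_size D) size_tuple.
have BQ : [set j : 'I_(m + r) | nth false w j] \in bases (gcat_matroid Q).
  by rewrite [_ \in _]gcat_bases_dom e.
by exists (exist (fun B => B \in bases (gcat_matroid Q)) _ BQ); rewrite /wd /= e.
Qed.

Let basis_graphE B B' : basis_graph B B' = adj (wd B) (wd B').
Proof.
rewrite adj_hamming ?(dom_size (dom_wd _)) // /basis_graph hamming_word_of.
by rewrite (dom_count (dom_wd B)) (dom_count (dom_wd B')) eqxx.
Qed.

Lemma card_basis : corners q < #|V|.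
Proof.
have [s [us ss Ds]] := many_words (leqnn (corners q)).
apply: leq_trans ss _; have -> : size s = size (filter (mem (map wd (enum V))) s).
  rewrite (all_filterP _) //; apply/allP=> w /Ds/wd_ex[B <-].
  by rewrite /= map_f // mem_enum.
rewrite cardE -(size_map wd); apply: uniq_leq_size; first exact: filter_uniq.
by move=> w; rewrite mem_filter => /andP[].
Qed.

(** The edge [eps] closes each Hamiltonian path between its ends to a cycle, and by
    [cycle_edges_inj] different paths give different cycles. *)
Lemma HC_lower n eps : 2 < #|V| -> good n q ->
  eps \in edges (@basis_graph _ (gcat_matroid Q)) -> n <= HC eps.
Proof.
move=> V3 G /imsetP[[B1 B2]]; rewrite inE /= => B12 ->.
have [|L [uL sL HL]] := G (wd B1) (wd B2).
  by split; [exact: dom_wd|exact: dom_wd|left; rewrite -basis_graphE].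
(* The default [B1] is reached only for words that are not below [Q]. *)
pose inv w : V := odflt B1 [pick B | wd B == w].
have invK B : inv (wd B) = B.
  rewrite /inv; case: pickP => [B' /eqP/wd_inj//|/(_ B)]; by rewrite eqxx.
have wdK w : dom 0 w q -> wd (inv w) = w by case/wd_ex=> B <-; rewrite invK.
have inL p : p \in L -> exists s, [/\ map inv p = B1 :: s, p = map wd (B1 :: s),
    uniq (B1 :: s), size (B1 :: s) = #|V| &
    last B1 s = B2 /\ path (@basis_graph _ _) B1 s].
  move=> /HL[hp lp sp up' mp].
  have pE : p = map wd (map inv p).
    rewrite -map_comp map_id_in // => w.
    by rewrite mp => Dw; rewrite /= wdK.
  have up1 : uniq (map inv p) by rewrite -(map_inj_uniq wd_inj) -pE.
  have full B : B \in map inv p.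
    by rewrite -(mem_map wd_inj) -pE mp; apply: dom_wd.
  have sz : size (map inv p) = #|V|.
    by rewrite -(card_uniqP up1); apply: eq_card => B; rewrite full.
  case e : (map inv p) => [|B s] in pE up1 full sz; first by have := full B1.
  have eB : B = B1 by apply: wd_inj; move: hp; rewrite pE => -[].
  subst B; exists s; split=> //; split.
    by apply: wd_inj; rewrite -last_map -lp pE.
  move: sp; rewrite pE /= path_map; apply: sub_path => x y /=.
  by rewrite basis_graphE.
pose F p := cycle_edges (map inv p).
have injF : {in L &, injective F}.
  move=> p p' pL p'L; have [s [e -> us ss [ls _]]] := inL p pL.
  have [s' [e' -> us' ss' [ls' _]]] := inL p' p'L.
  rewrite /F -!map_comp !(eq_map (invK : inv \o wd =1 id)) !map_id => eE.
  congr (map wd (_ :: _)); apply: cycle_edges_inj us us' _ _ _ eE.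
  - by rewrite -ltnS -[(size s).+1]/(size (B1 :: s)) ss.
  - by apply/eqP; rewrite -eqSS -[(size s).+1]/(size (B1 :: s)) ss -ss'.
  - by rewrite ls ls'.
apply: leq_trans sL _; rewrite -(size_map F).
have uF : uniq (map F L) by rewrite map_inj_in_uniq.
rewrite -(card_uniqP uF); apply: subset_leq_card; apply/subsetP=> _ /mapP[p pL ->].
have [s [e _ us ss [ls ps]]] := inL p pL; rewrite inE /F e; apply/andP; split.
  apply/imsetP; exists (Tuple (introT eqP ss)) => //.
  rewrite inE V3 andbT /ucycleb us andbT /= rcons_path ps ls /=.
  by rewrite basis_graphE adjC -basis_graphE.
(* The edge [eps] is the closing one, from the last vertex back to [B1]. *)
apply/imsetP; exists B2; first by rewrite -ls mem_last.
have [_ pE] := cycle_traject us.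
have -> : next (B1 :: s) B2 = B1 by rewrite -ls -pE next_prev.
by rewrite setUC.
Qed.

Lemma HCstar_lower n : 2 < #|V| -> good n q -> n <= HCstar (gcat_matroid Q).
Proof.
(* An edge must exist for [HCstar] to be attained at one; more than one vertex suffices by
   [neighbour_or_single]. *)
move=> V3 G; have ne : edges (@basis_graph _ (gcat_matroid Q)) != set0.
  have [[x' Dx' a]|S] := neighbour_or_single (dom_refl q); last first.
    have : #|V| <= 1; last by lia.
    by apply/card_le1_eqP=> B B' _ _; apply: wd_inj; rewrite (S _ (dom_wd B)) (S _ (dom_wd B')).
  have [B eB] := wd_ex (dom_refl q); have [B' eB'] := wd_ex Dx'.
  apply/set0Pn; exists [set B; B']; apply/imsetP; exists (B, B') => //.
  by rewrite inE /= basis_graphE eB eB'.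
by have [eps epsE [-> _]] := HCstarP ne; apply: HC_lower.
Qed.

End Transfer.

Theorem theorem3p5 (k : nat) (hk : 2 <= k) : sf (k - 1) * sf (k - 2) <= hcl k.
Proof.
rewrite /hcl; case: ex_minnP => n /boolp.asboolP[m [r [Q [mi ->]]]] _.
have ck := corners_of_minor mi.
(* Two corners already give more than two vertices. *)
apply: HCstar_lower; first exact: leq_ltn_trans (leq_trans hk ck) (card_basis Q).
case: k hk mi ck => [|[|k]] // _ _ ck.
by rewrite subn1 subn2; apply: good_catalan.
Qed.
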